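(* Let $p\ge2$ be real and let $N$ be an integer with $N\ge 1+p(p-1)$. Set $\Lambda_p:=\left(\frac{N-1}{p}\right)^p$ and $r:=\varrho(x,x_0)$ with $x_0\in\mathbb{H}^N$ fixed. For $p>2$ let $r_p=r_p(N)$ be the unique positive solution of the equation $$\coth r_p-1-\frac{p-1}{N-1}\,\frac{1}{r_p}=0,$$ and let $r_2:=+\infty$ (so that $B(x_0,r_2)=\mathbb{H}^N$). Then for all $u\in C_c^\infty(B(x_0,r_p))$ $$\int_{B(x_0,r_p)}|\nabla_{\mathbb{H}^N}u|^p\,{\rm d}v_{\mathbb{H}^N}-\Lambda_p\int_{B(x_0,r_p)}|u|^p\,{\rm d}v_{\mathbb{H}^N}\ \ge\ \frac{(p-1)^{p-1}(N(p-2)+1)}{p^p}\int_{B(x_0,r_p)}\frac{|u|^p}{r^p}\,{\rm d}v_{\mathbb{H}^N}$$ $$\qquad+\ \frac{(N-1)(N-1-p(p-1))(p-1)^{p-2}}{p^p}\int_{B(x_0,r_p)}\frac{|u|^p}{\sinh^p r}\,{\rm d}v_{\mathbb{H}^N}.$$ In particular, for every $p>2$ the map $N\mapsto r_p(N)$ is strictly increasing in $[1+p(p-1),+\infty)$ and $\lim_{N\to+\infty}r_p(N)=+\infty$, while for every $N>3$ the map $p\mapsto r_p$ is strictly decreasing in $\left(2,\frac{1+\sqrt{4N-3}}{2}\right]$.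
   Context: $\mathbb{H}^N$ is the hyperbolic space of dimension $N$ (constant sectional curvature $-1$); $\nabla_{\mathbb{H}^N}$ and ${\rm d}v_{\mathbb{H}^N}$ denote its Riemannian gradient and Riemannian measure, and $|\nabla_{\mathbb{H}^N}u|$ is the Riemannian norm of the gradient. $\varrho(x,x_0)$ is the geodesic distance between $x$ and $x_0$, and $B(x_0,R)$ is the geodesic ball of radius $R$ centered at $x_0$. In the monotonicity statements, $r_p(N)$ is defined by the displayed scalar equation, in which $N$ may be regarded as a real parameter. *)

(* Defs.v *)
From HB Require Import structures.
From mathcomp Require Import all_boot all_order all_algebra.
From mathcomp Require Import all_classical all_reals all_analysis.
Import Order.TTheory GRing.Theory Num.Theory numFieldNormedType.Exports.

Set Implicit Arguments.
Unset Strict Implicit.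
Unset Printing Implicit Defensive.

Local Open Scope classical_set_scope.
Local Open Scope ring_scope.

Section cons_pair.
Context d (T : measurableType d) (n : nat).

Definition cons_pair (z : T * n.-tuple T) : n.+1.-tuple T :=
  [tuple of z.1 :: z.2].

Lemma measurable_cons_pair : measurable_fun setT cons_pair.
Proof. exact: measurable_cons. Qed.

End cons_pair.

Section pushforward_product.
Local Open Scope ereal_scope.
Context d1 d2 d (T1 : measurableType d1) (T2 : measurableType d2)
  (T : measurableType d) (R : realType).
Variable m1 : {sigma_finite_measure set T1 -> \bar R}.
Variable m2 : {sigma_finite_measure set T2 -> \bar R}.
Variables (f : T1 * T2 -> T) (g : T -> T1 * T2).
Hypotheses (mf : measurable_fun setT f) (mg : measurable_fun setT g).
Hypothesis fK : cancel f g.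

Lemma pushforward_product_sigma_finite :
  exists m : {sigma_finite_measure set T -> \bar R},
    pushforward (m1 \x m2) f = m.
Proof.
pose nu := measure_function_pushforward__canonical__measure_function_Measure
  (m1 \x m2) mf.
have sf : sigma_finite setT nu.
  have /sigma_finiteP[F [TF ndF Foo]] := sigma_finiteT m1.
  have /sigma_finiteP[G [TG ndG Goo]] := sigma_finiteT m2.
  exists (fun k => g @^-1` (F k `*` G k)).
    rewrite -preimage_bigcup [X in g @^-1` X](_ : _ = setT) ?preimage_setT//.
    rewrite -setXTT TF TG predeqE => -[x y]; split=> [[k _ []/= ? ?]|].
      by split; exists k.
    move=> [/= [k _ Fkx] [l _ Gly]]; exists (maxn k l) => //; split.
    - by move: x Fkx; exact/subsetPset/ndF/leq_maxl.
    - by move: y Gly; exact/subsetPset/ndG/leq_maxr.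
  move=> k; have [mFk Fkoo] := Foo k; have [mGk Gkoo] := Goo k; split.
    by rewrite -[X in measurable X]setTI; apply: mg => //; exact: measurableX.
  rewrite /nu /= /pushforward -comp_preimage.
  rewrite (_ : g \o f = id); last by apply/funext => z; exact: fK.
  by rewrite preimage_id product_measure1E// lte_mul_pinfty// ge0_fin_numE.
pose h := Measure_isSigmaFinite.Build _ _ _ nu sf.
pose nu' : {sigma_finite_measure set T -> \bar R} :=
  HB.pack (Measure.sort nu) (Measure.class nu) h.
by exists nu'.
Qed.

End pushforward_product.

Section lebesgue_tuple.
Variable R : realType.
Local Open Scope ereal_scope.
Local Notation RR := (measurableTypeR R).

(* Lebesgue measure on R^n (product sigma-algebra), as an iterated product. *)
Fixpoint lebesgue_tuple n : set (n.-tuple RR) -> \bar R :=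
  match n with
  | 0 => dirac [tuple]
  | n'.+1 => pushforward (@lebesgue_measure R \x @lebesgue_tuple n')
               (@cons_pair _ RR n')
  end.

Lemma lebesgue_tuple_sigma_finite_measure n :
  exists m : {sigma_finite_measure set n.-tuple RR -> \bar R},
    @lebesgue_tuple n = m.
Proof.
elim: n => [|n [m IH]]; first by exists (dirac [tuple]).
pose g (t : n.+1.-tuple RR) : (RR * n.-tuple RR)%type :=
  (tnth t ord0, [tuple of behead t]).
have mg : measurable_fun setT g.
  apply/measurable_fun_pairP; split; first exact: measurable_tnth.
  exact: measurable_behead.
have gK : cancel (@cons_pair _ RR n) g.
  by case=> a t; congr pair; apply/val_inj.
have [m' m'E] := pushforward_product_sigma_finite (@lebesgue_measure R) m
  (@measurable_cons_pair _ RR n) mg gK.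
by exists m'; rewrite -m'E -IH.
Qed.

Let tuple0 n : @lebesgue_tuple n set0 = 0.
Proof. by have [m ->] := lebesgue_tuple_sigma_finite_measure n. Qed.

Let tuple_ge0 n A : 0 <= @lebesgue_tuple n A.
Proof. by have [m ->] := lebesgue_tuple_sigma_finite_measure n. Qed.

Let tuple_sigma_additive n : semi_sigma_additive (@lebesgue_tuple n).
Proof.
have [m ->] := lebesgue_tuple_sigma_finite_measure n.
exact: measure_semi_sigma_additive.
Qed.

HB.instance Definition _ n := isMeasure.Build _ _ _ (@lebesgue_tuple n)
  (@tuple0 n) (@tuple_ge0 n) (@tuple_sigma_additive n).

Let tuple_sigma_finite n : sigma_finite setT (@lebesgue_tuple n).
Proof.
have [m ->] := lebesgue_tuple_sigma_finite_measure n.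
exact: sigma_finiteT.
Qed.

HB.instance Definition _ n :=
  Measure_isSigmaFinite.Build _ _ _ (@lebesgue_tuple n) (@tuple_sigma_finite n).
End lebesgue_tuple.

Section hyperbolic_functions.
Variable R : realType.
Implicit Types x : R.

Definition sinh x := (expR x - expR (- x)) / 2.
Definition cosh x := (expR x + expR (- x)) / 2.
Definition coth x := cosh x / sinh x.

End hyperbolic_functions.

Section smooth.
Variables (R : realType) (V : normedModType R).

Fixpoint Ck (k : nat) (f : V -> R) : Prop :=
  match k with
  | 0 => continuous f
  | k'.+1 => (forall x, differentiable f x) /\ forall v, Ck k' ('D_v f)
  end.

Definition smooth (f : V -> R) := forall k, Ck k f.

(* C_c^oo(B) for B open: each such function is identified with its extension
   by zero, which is smooth on the whole space. *)
Definition test_function (B : set V) (f : V -> R) :=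
  smooth f /\
  exists K : set V, [/\ compact K, K `<=` B & forall x, ~ K x -> f x = 0].

End smooth.

(* Poincare ball model of H^N: the open Euclidean unit ball with the metric
   4 |dx|^2 / (1 - |x|^2)^2, of constant curvature -1. The norm of 'rV[R]_N in
   the library is the sup norm, hence the explicit sums of squares. *)
Section poincare_ball.
Variables (R : realType) (N : nat).
Implicit Types (x y v : 'rV[R]_N) (u : 'rV[R]_N -> R).

Definition hyp_space : set 'rV[R]_N := [set x | \sum_i x 0 i ^+ 2 < 1].

Definition hyp_metric x : 'M[R]_N :=
  ((2 / (1 - \sum_i x 0 i ^+ 2)) ^+ 2)%:M.

Definition riem_norm x v := Num.sqrt ((v *m hyp_metric x *m v^T) 0 0).

(* In coordinates, grad u = (du) g^-1. *)
Definition riem_grad u x : 'rV[R]_N :=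
  (\row_i 'D_(delta_mx 0 i) u x) *m invmx (hyp_metric x).

(* The Riemannian measure is sqrt (det g) dx. *)
Definition riem_integral (B : set 'rV[R]_N) (f : 'rV[R]_N -> R) : \bar R :=
  let pt (t : N.-tuple (measurableTypeR R)) := \row_i (tnth t i : R) in
  (\int[@lebesgue_tuple R N]_(t in pt @^-1` B)
     (f (pt t) * Num.sqrt (\det (hyp_metric (pt t))))%:E)%E.

(* C^1 curves from x to y in H^N, parametrized by [0, 1]; c is defined on all
   of R (a C^1 curve on [0, 1] extends) to avoid one-sided derivatives, and its
   values outside [0, 1] are irrelevant. *)
Definition hyp_curve x y : set (R -> 'rV[R]_N) :=
  [set c : R -> 'rV[R]_N | [/\ c 0 = x, c 1 = y,
               forall t : R, derivable c t 1,
               continuous (derive1 c) &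
               forall t : R, 0 <= t <= 1 -> hyp_space (c t)]].

Definition curve_length (c : R -> 'rV[R]_N) : R :=
  \int[@lebesgue_measure R]_(t in `[0, 1]) riem_norm (c t) (derive1 c t).

Definition geodesic_dist x y : R := inf [set curve_length c | c in hyp_curve x y].

Definition geodesic_ball x0 (r : \bar R) : set 'rV[R]_N :=
  [set x | hyp_space x /\ ((geodesic_dist x x0)%:E < r)%E].

End poincare_ball.

Section radius.
Variable R : realType.
Implicit Types p N r : R.

Definition is_rp p N : set R :=
  [set r | 0 < r /\ coth r - 1 - (p - 1) / (N - 1) * r^-1 = 0].

(* The chosen element of [is_rp p N] (0 when there is none); used for p > 2. *)
Definition rp p N : R := xget 0 (is_rp p N).

Definition rp_ext p N : \bar R := if p == 2 then +oo%E else (rp p N)%:E.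

End radius.

(* Main.v *)
Require Import Defs.
From mathcomp Require Import all_boot all_order all_algebra.
From mathcomp Require Import all_classical all_reals all_analysis.
From mathcomp Require Import measurable_realfun ring lra.
Set Implicit Arguments.
Unset Strict Implicit.
Unset Printing Implicit Defensive.

Import Order.TTheory GRing.Theory Num.Theory numFieldNormedType.Exports.
Local Open Scope classical_set_scope.
Local Open Scope ring_scope.

(** The proof is the method of supersolutions. Write r for the distance from
    x0, a = (N-1)/p and b = (p-1)/p. The radial function
    v = r^b (sinh r)^(-a) has -v'/v = g with g(r) = a coth r - b/r > 0. With
    X = g^(p-1) grad r, Young's inequality gives, pointwise,
      |grad u|^p + div (|u|^p X) >= |u|^p (div X - (p-1) g^p),
    and the divergence integrates to 0. As the Laplacian of r is (N-1) coth r,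
    the parenthesis on the right equals
      g^(p-2) (a^2 + a (a-(p-1)) / sinh^2 r + b^2 / r^2 + (p-2) a b coth r / r).
    Since coth r >= 1/r, a >= p-1 >= 2b and sinh r >= r, one has
    g >= b/r >= b / sinh r. Moreover g >= a is exactly the condition r <= r_p
    (the equation of r_p, times a), and for p = 2 the factor g^(p-2) is 1.
    Inserting the appropriate bound for g^(p-2) in front of each term gives the
    weight Lambda_p + c1 / r^p + c2 / sinh^p r of the theorem
    (hardy_weight_le). This is where N >= 1 + p (p-1), that is a >= p-1, is
    used.

    In the ball model, everything is expressed by q = cosh r, which has the
    rational expression cosh_dist. The two facts about r are then algebraic
    identities: |grad q|^2 = q^2 - 1 (sqn_grad_cosh) and that the Laplacian of
    q is N q (sum_dflux). The geodesic distance is defined as an infimum of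
    lengths; by the first identity, arcosh q is a lower bound for it
    (arcosh_le_geodesic_dist), and this suffices, since the right-hand side
    decreases with the distance and a smaller distance stays inside the ball
    where g >= a.

    The field X is singular at x0. It is multiplied by a cutoff that vanishes
    near x0, is at most 1 and is nondecreasing in r: the divergence only
    increases by the derivative of the cutoff, and the inequality persists
    with the cutoff on the right (hardy_pointwise). Monotone convergence
    removes the cutoff (hardy_limit). The divergence theorem for a C^1 field
    with compact support is Fubini's theorem and the fundamental theorem of
    calculus on lines (integral_lines_eq0, integral_partial_eq0).

    The equation of r_p reads (exp y - 1) / y = (N-1)/(p-1) with y = 2 r_p
    (is_rpE). Its left-hand side increases strictly from 1 to infinity with y
    (expR_chord_lt), which gives existence and uniqueness as well as the
    dependence of r_p on p and N (rp_mono, rp_cvgy). *)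

(** * Hyperbolic functions *)

Section hyperbolic_theory.
Context {R : realType}.
Implicit Types p q a b r x y z : R.

Lemma is_derive_sinh x : is_derive x 1 (@sinh R) (cosh x).
Proof.
have -> : @sinh R = (fun y => 2^-1 * (expR y - expR (- y))).
  by apply/funext => y; rewrite /sinh mulrC.
apply: is_derive_eq; rewrite /cosh /GRing.scale /=; ring.
Qed.

Lemma is_derive_cosh x : is_derive x 1 (@cosh R) (sinh x).
Proof.
have -> : @cosh R = (fun y => 2^-1 * (expR y + expR (- y))).
  by apply/funext => y; rewrite /cosh mulrC.
apply: is_derive_eq; rewrite /sinh /GRing.scale /=; ring.
Qed.

Lemma sinh0 : sinh 0 = 0 :> R.
Proof. by rewrite /sinh oppr0 subrr mul0r. Qed.

Lemma sinh_gt0 r : 0 < r -> 0 < sinh r.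
Proof. by move=> r0; rewrite divr_gt0// subr_gt0 ltr_expR; lra. Qed.

Lemma sinh_ge0 r : 0 <= r -> 0 <= sinh r.
Proof. by rewrite le_eqVlt => /predU1P[<-|/sinh_gt0/ltW//]; rewrite sinh0. Qed.

Lemma cosh2_sinh2 r : cosh r ^+ 2 - sinh r ^+ 2 = 1.
Proof.
rewrite /cosh /sinh expRN; field; rewrite gt_eqF ?expR_gt0//.
Qed.

Lemma cosh_gt0 r : 0 < cosh r.
Proof. by rewrite divr_gt0// addr_gt0 ?expR_gt0. Qed.

Lemma cosh_ge1 r : 1 <= cosh r.
Proof. by have := cosh2_sinh2 r; have := cosh_gt0 r; nra. Qed.

Lemma cosh_gt1 r : 0 < r -> 1 < cosh r.
Proof.
by move=> /sinh_gt0; have := cosh2_sinh2 r; have := cosh_gt0 r; nra.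
Qed.

Lemma le0_of_derive (f df : R -> R) r : (forall x, is_derive x 1 f (df x)) ->
  (forall x, 0 <= x -> 0 <= df x) -> 0 <= r -> f 0 <= f r.
Proof.
move=> fd df0 r0.
have cf : {within `[0, r], continuous f}.
  apply: continuous_subspaceT => x.
  by apply/differentiable_continuous/derivable1_diffP; case: (fd x).
have [c /[!in_itv]/= /andP[c0 cr] h] := MVT_segment r0 (fun x _ => fd x) cf.
by rewrite -subr_ge0 h subr0 mulr_ge0// df0.
Qed.

Lemma le_sinh r : 0 <= r -> r <= sinh r.
Proof.
move=> r0.
have h x : is_derive x 1 (fun z => sinh z - z) (cosh x - 1).
  by apply: is_deriveB; exact: is_derive_sinh.
have := le0_of_derive h _ r0; rewrite sinh0 subr0 subr_ge0; apply => x _.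
by rewrite subr_ge0 cosh_ge1.
Qed.

Lemma sinh_le_cosh r : 0 <= r -> sinh r <= r * cosh r.
Proof.
move=> r0.
have h x : is_derive x 1 (fun z => z * cosh z - sinh z) (x * sinh x).
  have := is_derive_sinh x; have := is_derive_cosh x => ? ?.
  apply: is_derive_eq; rewrite /GRing.scale /=; ring.
have := le0_of_derive h _ r0; rewrite sinh0 mul0r subrr subr_ge0; apply => x x0.
by rewrite mulr_ge0// sinh_ge0.
Qed.

Lemma coth_ge_inv r : 0 < r -> r^-1 <= coth r.
Proof.
move=> r0; rewrite /coth ler_pdivlMr ?sinh_gt0// ler_pdivrMl//.
by rewrite sinh_le_cosh// ltW.
Qed.

Lemma cosh2 r : cosh r ^+ 2 = 1 + sinh r ^+ 2.
Proof. by rewrite -(cosh2_sinh2 r); ring. Qed.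

Lemma coth2 r : 0 < r -> coth r ^+ 2 = 1 + (sinh r ^+ 2)^-1.
Proof.
by move=> /sinh_gt0 s0; rewrite /coth expr_div_n cosh2; field; rewrite gt_eqF.
Qed.

Lemma is_derive_coth x : 0 < x -> is_derive x 1 (@coth R) (- (sinh x ^+ 2)^-1).
Proof.
move=> x0; have s0 := sinh_gt0 x0; have sn : sinh x != 0 by rewrite gt_eqF.
have := is_derive_sinh x; have := is_derive_cosh x => ? ?.
have ? := is_deriveV sn (is_derive_sinh x).
apply: is_derive_eq; rewrite /GRing.scale /=.
apply/eqP; rewrite -subr_eq0; apply/eqP.
transitivity ((1 + sinh x ^+ 2 - cosh x ^+ 2) / sinh x ^+ 2); first by field.
by rewrite cosh2; field.
Qed.

Definition arcosh y := ln (y + Num.sqrt (y ^+ 2 - 1)).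

Lemma arcosh_arg_ge1 y : 1 <= y -> 1 <= y + Num.sqrt (y ^+ 2 - 1).
Proof. by move=> y1; rewrite ler_wpDr ?sqrtr_ge0. Qed.

Lemma expR_arcosh y : 1 <= y -> expR (arcosh y) = y + Num.sqrt (y ^+ 2 - 1).
Proof. by move=> /arcosh_arg_ge1 h; rewrite lnK// posrE; lra. Qed.

Lemma expRN_arcosh y : 1 <= y -> expR (- arcosh y) = y - Num.sqrt (y ^+ 2 - 1).
Proof.
move=> y1; have h := arcosh_arg_ge1 y1; rewrite expRN expR_arcosh//.
have s2 : Num.sqrt (y ^+ 2 - 1) ^+ 2 = y ^+ 2 - 1 by rewrite sqr_sqrtr//; nra.
apply: (@mulfI _ (y + Num.sqrt (y ^+ 2 - 1))); first by rewrite gt_eqF//; lra.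
rewrite divff; last by rewrite gt_eqF//; lra.
have -> : forall s, (y + s) * (y - s) = y ^+ 2 - s ^+ 2 by move=> s; ring.
by rewrite s2; ring.
Qed.

Lemma cosh_arcosh y : 1 <= y -> cosh (arcosh y) = y.
Proof. by move=> y1; rewrite /cosh expR_arcosh// expRN_arcosh//; field. Qed.

Lemma sinh_arcosh y : 1 <= y -> sinh (arcosh y) = Num.sqrt (y ^+ 2 - 1).
Proof. by move=> y1; rewrite /sinh expR_arcosh// expRN_arcosh//; field. Qed.

Lemma arcosh_gt0 y : 1 < y -> 0 < arcosh y.
Proof. by move=> y1; apply: ln_gt0; rewrite ltr_wpDr ?sqrtr_ge0. Qed.

Lemma arcosh1 : arcosh 1 = 0.
Proof. by rewrite /arcosh expr1n subrr sqrtr0 addr0 ln1. Qed.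

Lemma coshK r : 0 <= r -> arcosh (cosh r) = r.
Proof.
move=> r0; rewrite -[RHS]expRK /arcosh; congr ln.
have -> : cosh r ^+ 2 - 1 = sinh r ^+ 2 by rewrite -(cosh2_sinh2 r); ring.
rewrite sqrtr_sqr ger0_norm ?sinh_ge0// /cosh /sinh.
by field.
Qed.

Lemma ler_arcosh y z : 1 <= y -> y <= z -> arcosh y <= arcosh z.
Proof.
move=> y1 yz; rewrite ler_ln ?posrE ?(lt_le_trans ltr01)//; last first.
- by apply: arcosh_arg_ge1; lra.
- exact: arcosh_arg_ge1.
by rewrite lerD// ler_wsqrtr// lerD2r; nra.
Qed.

Lemma is_derive_arcosh y : 1 < y ->
  is_derive y 1 arcosh (Num.sqrt (y ^+ 2 - 1))^-1.
Proof.
move=> y1; have h0 : 0 < y ^+ 2 - 1 by nra.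
have s0 : 0 < Num.sqrt (y ^+ 2 - 1) by rewrite sqrtr_gt0.
have h1 : is_derive y 1 (fun z : R => z ^+ 2 - 1) (2 * y).
  by apply: is_derive_eq; rewrite /GRing.scale /=; ring.
have h2 := @is_derive1_comp R Num.sqrt (fun z => z ^+ 2 - 1) y _ _
  (is_derive1_sqrt h0) h1.
have h3 : is_derive y 1 (fun z : R => z + Num.sqrt (z ^+ 2 - 1))
    (1 + (2 * Num.sqrt (y ^+ 2 - 1))^-1 * (2 * y)).
  exact: is_deriveD.
have a0 : 0 < y + Num.sqrt (y ^+ 2 - 1) by lra.
apply: is_derive_eq.
  exact: (@is_derive1_comp R (@ln R) (fun z => z + Num.sqrt (z ^+ 2 - 1)) y _ _
    (is_derive1_ln a0) h3).
by field; rewrite !gt_eqF//=; lra.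
Qed.

End hyperbolic_theory.

(** * The radius of the ball *)

Section radius_theory.
Context {R : realType}.
Implicit Types p q N M r x y z k : R.

Lemma expR_gt_tangent y z : z != y -> expR y * (1 + z - y) < expR z.
Proof.
move=> zy; have -> : expR z = expR y * expR (z - y) by rewrite -expRD addrC subrK.
by rewrite ltr_pM2l ?expR_gt0// -addrA; apply: expR_gt1Dx; rewrite subr_eq0.
Qed.

(** The chord slope (exp y - 1) / y increases with y: the tangent at y has a
    slope strictly between those of the chords over [0, y] and over [y, z]. *)
Lemma expR_chord_lt y z : 0 < y -> y < z ->
  (expR y - 1) * z < (expR z - 1) * y.
Proof.
move=> y0 yz.
have h1 : expR y * (1 + z - y) < expR z by apply: expR_gt_tangent; rewrite gt_eqF.
have h2 : expR y * (1 + 0 - y) < 1.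
  by rewrite -[ltRHS]expR0; apply: expR_gt_tangent; rewrite lt_eqF.
nra.
Qed.

(** The next two lemmas compare a point y with the solution z of the chord
    equation, according to the side of the equation on which y lies. *)
Lemma chord_slope_lt y z k : 0 < y -> 0 < z -> 0 < k ->
  k * (expR z - 1) = z -> k * (expR y - 1) < y -> y < z.
Proof.
move=> y0 z0 k0 kz ky; rewrite ltNge le_eqVlt; apply/negP => /predU1P[zy|zy].
  by move: ky; rewrite -zy kz ltxx.
have := @expR_chord_lt _ _ z0 zy; nra.
Qed.

Lemma chord_slope_gt y z k : 0 < y -> 0 < z -> 0 < k ->
  k * (expR z - 1) = z -> y < z -> k * (expR y - 1) < y.
Proof. by move=> y0 z0 k0 kz yz; have := @expR_chord_lt _ _ y0 yz; nra. Qed.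

(** Existence by the intermediate value theorem. At -ln k, where exp y = 1/k,
    the difference of the two sides is 1 - k + ln k < 0; at the larger point
    4/k - ln k it is positive, by exp y >= (1 + y/2)^2. *)
Lemma chord_slope_ex k : 0 < k -> k < 1 -> exists2 y, 0 < y & k * (expR y - 1) = y.
Proof.
move=> k0 k1.
pose f x := k * (expR x - 1) - x.
have cf : continuous f.
  move=> x; apply: cvgB; last exact: cvg_id.
  apply: cvgM; first exact: cvg_cst.
  by apply: cvgB; [exact: continuous_expR|exact: cvg_cst].
have lnk : 1 + ln k < k.
  by rewrite -[ltRHS]lnK ?posrE//; apply: expR_gt1Dx; rewrite ln_eq0// lt_eqF.
have lnk0 : 0 < - ln k by rewrite oppr_gt0 ln_lt0// k0.
have fa : f (- ln k) < 0.
  rewrite /f expRN lnK ?posrE// mulrBr divff ?gt_eqF// mulr1; lra.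
pose b := 4 / k - ln k.
have k4 : 0 < 4 / k by rewrite divr_gt0.
have fb : 0 < f b.
  have b4 : 4 < k * b.
    by rewrite /b mulrBr mulrCA divff ?gt_eqF// mulr1; nra.
  have b0 : 0 < b by rewrite /b; lra.
  have e1 : (1 + b / 2) ^+ 2 <= expR b.
    rewrite [in leRHS](splitr b) expRD -expr2.
    by rewrite ler_pXn2r ?nnegrE ?expR_ge0 ?expR_ge1Dx//; lra.
  have : k * (1 + b / 2) ^+ 2 <= k * expR b by rewrite ler_pM2l.
  rewrite /f expr2; nra.
have ab : - ln k <= b by rewrite /b; lra.
have fab : Num.min (f (- ln k)) (f b) <= 0 <= Num.max (f (- ln k)) (f b).
  by rewrite ge_min (ltW fa)/= le_max (ltW fb) orbT.
have [c /[!in_itv]/= /andP[ac cb] fc0] := IVT ab (continuous_subspaceT cf) fab.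
exists c; first exact: lt_le_trans ac.
by apply/eqP; rewrite -subr_eq0; apply/eqP.
Qed.

Lemma coth_sub1 r : 0 < r -> coth r - 1 = 2 / (expR (2 * r) - 1).
Proof.
move=> r0; have := sinh_gt0 r0; rewrite /coth /cosh /sinh => s0.
have e0 := expR_gt0 r; have e1 : 1 < expR r by rewrite expR_gt1.
have -> : expR (2 * r) = expR r * expR r by rewrite -expRD; congr expR; ring.
rewrite expRN in s0 *; field; rewrite !gt_eqF//; nra.
Qed.

(** Since coth r - 1 = 2 / (exp (2 r) - 1), the equation of the radius says
    that the chord slope (exp y - 1) / y at y = 2 r equals (N-1)/(p-1). *)
Lemma is_rpE p N r : 1 < p -> 1 < N ->
  is_rp p N r <->
  0 < r /\ (p - 1) / (N - 1) * (expR (2 * r) - 1) = 2 * r.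
Proof.
move=> p1 N1; rewrite /is_rp /=; split=> -[r0 h]; split=> //; move: h;
  rewrite coth_sub1//.
all: have e0 : expR (2 * r) - 1 != 0 by rewrite gt_eqF// subr_gt0 expR_gt1; lra.
all: set k := (p - 1) / (N - 1); set e := expR _ - 1 in e0 *.
- move/eqP; rewrite subr_eq0 => /eqP h.
  have -> : k * e = k * r^-1 * (r * e) by field; rewrite (gt_eqF r0).
  by rewrite -h; field.
- move=> h; have -> : k = 2 * r / e by rewrite -h; field.
  by field; rewrite e0 (gt_eqF r0).
Qed.

Lemma slope_itv p N : 1 < p -> 1 + p * (p - 1) <= N ->
  0 < (p - 1) / (N - 1) < 1.
Proof.
move=> p1 pN; have N1 : 0 < N - 1 by nra.
have q1 : 0 < p - 1 by rewrite subr_gt0.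
by rewrite divr_gt0//= ltr_pdivrMr// mul1r; nra.
Qed.

Lemma is_rp_ex p N : 1 < p -> 1 + p * (p - 1) <= N -> exists r, is_rp p N r.
Proof.
move=> p1 pN; have /andP[k0 k1] := slope_itv p1 pN.
have [y y0 yE] := chord_slope_ex k0 k1.
exists (y / 2); apply/is_rpE => //; first nra.
split; first by rewrite divr_gt0.
by have -> : 2 * (y / 2) = y by field.
Qed.

Lemma rpP p N : 1 < p -> 1 + p * (p - 1) <= N -> is_rp p N (rp p N).
Proof. by move=> p1 pN; exact: xgetPex (is_rp_ex p1 pN). Qed.

Lemma lt_rp p N r : 1 < p -> 1 + p * (p - 1) <= N -> 0 < r ->
  (r < rp p N) = ((p - 1) / (N - 1) * (expR (2 * r) - 1) < 2 * r).
Proof.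
move=> p1 pN r0; have /andP[k0 k1] := slope_itv p1 pN.
have N1 : 1 < N by nra.
have /(is_rpE _ p1 N1)[R0 RE] := rpP p1 pN.
apply/idP/idP => h; last first.
  by rewrite -(@ltr_pM2l _ 2)//; apply: (chord_slope_lt _ _ k0 RE h); rewrite mulr_gt0.
by apply: (chord_slope_gt _ _ k0 RE); rewrite ?mulr_gt0 ?ltr_pM2l.
Qed.

Lemma is_rp_uniq p N : 2 < p -> 1 + p * (p - 1) <= N -> exists! r, is_rp p N r.
Proof.
move=> p2 pN; have p1 : 1 < p by lra.
have N1 : 1 < N by nra.
have /andP[k0 k1] := slope_itv p1 pN.
have [r rE] := is_rp_ex p1 pN; exists r; split=> // s.
move: rE => /is_rpE-/(_ p1 N1)[r0 rE] /is_rpE-/(_ p1 N1)[s0 sE].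
have [] := ltgtP r s => // rs.
- by have := @chord_slope_gt (2 * r) (2 * s) _ _ _ k0 sE; rewrite rE ltxx; lra.
- by have := @chord_slope_gt (2 * s) (2 * r) _ _ _ k0 rE; rewrite sE ltxx; lra.
Qed.

(** All the monotonicity statements come from this one: the radius depends on
    p and N through k = (p-1)/(N-1) only, and 1/k is the chord slope at 2 r_p. *)
Lemma rp_mono p q N M : 1 < p -> 1 + p * (p - 1) <= N -> 1 < q -> 1 + q * (q - 1) <= M ->
  (q - 1) / (M - 1) < (p - 1) / (N - 1) -> rp p N < rp q M.
Proof.
move=> p1 pN q1 qM kk.
have N1 : 1 < N by nra.
have /(is_rpE _ p1 N1)[r0 rE] := rpP p1 pN.
rewrite lt_rp// -[ltRHS]rE ltr_pM2r// subr_gt0 expR_gt1; lra.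
Qed.

Lemma rp_increasing p N M : 2 < p -> 1 + p * (p - 1) <= N -> N < M ->
  rp p N < rp p M.
Proof.
move=> p2 pN NM; apply: rp_mono; rewrite ?ltr_pM2l ?ltf_pV2 ?posrE; nra.
Qed.

Lemma rp_cvgy p : 2 < p -> rp p N @[N --> +oo] --> +oo.
Proof.
move=> p2; apply/cvgryPgt => A.
pose B := Num.max A 1.
have B0 : 0 < B by rewrite lt_max ltr01 orbT.
near=> N.
have pN : 1 + p * (p - 1) <= N by near: N; apply: nbhs_pinfty_ge; exact: num_real.
have N1 : 0 < N - 1 by nra.
apply: (@le_lt_trans _ _ B); first by rewrite le_max lexx.
rewrite lt_rp//; last lra.
rewrite mulrAC ltr_pdivrMr// -ltr_pdivrMl ?mulr_gt0// ltrBrDr.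
by near: N; apply: nbhs_pinfty_gt; exact: num_real.
Unshelve. all: by end_near. Qed.

Lemma rp_decreasing N p q : 3 < N -> 2 < p -> p < q ->
  q <= (1 + Num.sqrt (4 * N - 3)) / 2 -> rp q N < rp p N.
Proof.
move=> N3 p2 pq; set s := Num.sqrt _ => qs.
have s2 : s ^+ 2 = 4 * N - 3 by rewrite sqr_sqrtr//; lra.
have qN : 1 + q * (q - 1) <= N by nra.
apply: rp_mono => //; rewrite ?ltr_pM2r ?invr_gt0; nra.
Qed.

End radius_theory.

(** * The radial weight *)

Lemma gt0_powRD {R : realType} (x r s : R) : 0 < x ->
  x `^ (r + s) = x `^ r * x `^ s.
Proof. by move=> x0; rewrite powRD// (gt_eqF x0) implybT. Qed.

Lemma gt0_powR_div {R : realType} (x y s : R) : 0 < x -> 0 < y ->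
  (x / y) `^ s = x `^ s / y `^ s.
Proof.
move=> x0 y0; have yV0 : 0 <= y^-1 by rewrite invr_ge0 ltW.
rewrite powRM ?(ltW x0)//; congr (_ * _).
by rewrite -powRN -[in LHS]powR_inv1 ?(ltW y0)// -powRrM mulN1r.
Qed.

Section radial_weight.
Context {R : realType}.
Variables (p a : R).
Hypotheses (p2 : 2 <= p) (ap : p - 1 <= a).
Implicit Types r y : R.

Let b := (p - 1) / p.

(** Minus the logarithmic derivative of the radial supersolution
    r^b * (sinh r)^(-a). *)
Definition slope r := a * coth r - b / r.

Definition dslope r := - a / sinh r ^+ 2 + b / r ^+ 2.

(** The weight of the theorem, Lambda_p included, in terms of a = (N-1)/p and
    b = (p-1)/p: there its constants become a^p, b^(p-2) (b^2 + (p-2) a b) and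
    a (a - (p-1)) b^(p-2). *)
Definition hardy_weight r := a `^ p +
  b `^ (p - 2) * (b ^+ 2 + (p - 2) * a * b) / r `^ p +
  a * (a - (p - 1)) * b `^ (p - 2) / sinh r `^ p.

Let b_gt0 : 0 < b. Proof. by apply: divr_gt0; have := p2; lra. Qed.

Let a2b : 2 * b <= a.
Proof.
apply: le_trans ap; rewrite /b mulrA.
have ? := p2; rewrite ler_pdivrMr; [nra|lra].
Qed.

Lemma b_div_le_slope r : 0 < r -> b / r <= slope r.
Proof.
move=> r0; have := coth_ge_inv r0; rewrite /slope => h.
have ? := p2; have ? := ap.
have : a * r^-1 <= a * coth r by rewrite ler_wpM2l//; lra.
have : 2 * b * r^-1 <= a * r^-1 by rewrite ler_wpM2r// invr_ge0 ltW.
lra.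
Qed.

Lemma slope_gt0 r : 0 < r -> 0 < slope r.
Proof. by move=> r0; apply: lt_le_trans (b_div_le_slope r0); rewrite divr_gt0. Qed.

Lemma is_derive_slope r : 0 < r -> is_derive r 1 slope (dslope r).
Proof.
move=> r0; have rn : r != 0 by rewrite gt_eqF.
have ? := is_derive_coth r0; have ? := @is_deriveV R id r 1 1 rn (is_derive_id _ _).
rewrite /slope /dslope; apply: is_derive_eq; rewrite /GRing.scale /=; field.
by rewrite rn gt_eqF ?sinh_gt0.
Qed.

(** With g = slope, the p-Laplacian of the supersolution v is
    - g^(p-2) v^(p-1) times this Riccati expression. *)
Lemma riccati_slope r : 0 < r ->
  (p - 1) * dslope r + p * a * coth r * slope r - (p - 1) * slope r ^+ 2 =
  a ^+ 2 + a * (a - (p - 1)) / sinh r ^+ 2 + b ^+ 2 / r ^+ 2 +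
  (p - 2) * a * b * coth r / r.
Proof.
move=> r0; have rn : r != 0 by rewrite gt_eqF.
have sn : sinh r != 0 by rewrite gt_eqF ?sinh_gt0.
have pn : p != 0 by rewrite gt_eqF//; have := p2; lra.
have h := coth2 r0.
transitivity (a ^+ 2 * coth r ^+ 2 - (p - 1) * a / sinh r ^+ 2 + b ^+ 2 / r ^+ 2
   + (p - 2) * a * b * coth r / r).
  by rewrite /slope /dslope /b; field; rewrite pn rn sn.
by rewrite h; field; rewrite rn sn.
Qed.

(** Each of the three terms of the weight needs its own lower bound for the
    slope: a, b / r and b / sinh r. The first one is the definition of the
    radius r_p. *)
Lemma hardy_weight_le r : 0 < r -> p = 2 \/ a <= slope r ->
  hardy_weight r <= slope r `^ (p - 2) *
  ((p - 1) * dslope r + p * a * coth r * slope r - (p - 1) * slope r ^+ 2).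
Proof.
move=> r0 H; rewrite riccati_slope//.
have a0 : 0 < a by have := a2b; have := b_gt0; lra.
have s0 := sinh_gt0 r0.
have q0 : 0 <= p - 2 by have := p2; lra.
have powE x : 0 < x -> x `^ p = x `^ (p - 2) * x ^+ 2.
  by move=> x0; rewrite -powR_mulrn ?ltW// -gt0_powRD// subrK.
have hb := b_div_le_slope r0.
have h1 : a `^ (p - 2) <= slope r `^ (p - 2).
  case: H => [->|H]; first by rewrite subrr !powRr0.
  by apply: ge0_ler_powR; rewrite // nnegrE ltW// slope_gt0.
have h2 : (b / r) `^ (p - 2) <= slope r `^ (p - 2).
  by apply: ge0_ler_powR; rewrite // nnegrE ltW// ?slope_gt0// divr_gt0.
have h3 : (b / sinh r) `^ (p - 2) <= slope r `^ (p - 2).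
  apply: le_trans h2; apply: ge0_ler_powR; rewrite // ?nnegrE ?(ltW (divr_gt0 _ _))//.
  by rewrite ler_pM2l// lef_pV2 ?posrE// le_sinh ?ltW.
have divE x : 0 < x -> (b / x) `^ (p - 2) * (x ^+ 2)^-1 = b `^ (p - 2) / x `^ p.
  move=> x0; rewrite gt0_powR_div// powE//.
  by field; rewrite !gt_eqF ?powR_gt0.
rewrite /hardy_weight powE//.
set S := slope r `^ (p - 2) in h1 h2 h3 *; set B := b `^ (p - 2).
have -> : S * (a ^+ 2 + a * (a - (p - 1)) / sinh r ^+ 2 + b ^+ 2 / r ^+ 2 +
    (p - 2) * a * b * coth r / r) = S * a ^+ 2 +
  ((S * (r ^+ 2)^-1) * (b ^+ 2 + (p - 2) * a * b * (r * coth r)) +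
    a * (a - (p - 1)) * (S * (sinh r ^+ 2)^-1)).
  by field; rewrite (gt_eqF r0) (gt_eqF s0).
have -> : B * (b ^+ 2 + (p - 2) * a * b) / r `^ p =
    (b ^+ 2 + (p - 2) * a * b) * (B / r `^ p).
  by ring.
have c0 : 0 <= (p - 2) * a * b by apply: mulr_ge0; [apply: mulr_ge0 => //|]; exact: ltW.
rewrite -addrA; apply: lerD; first by rewrite ler_wpM2r ?sqr_ge0.
apply: lerD; last first.
  rewrite -mulrA; apply: ler_wpM2l; first by rewrite mulr_ge0 ?subr_ge0// ltW.
  by rewrite -divE// ler_wpM2r// invr_ge0 sqr_ge0.
rewrite -divE// mulrC; apply: ler_pM.
- by rewrite mulr_ge0 ?powR_ge0// invr_ge0 sqr_ge0.
- by rewrite addr_ge0 ?sqr_ge0.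
- by rewrite ler_wpM2r// invr_ge0 sqr_ge0.
- rewrite lerD2l ler_peMr// -ler_pdivrMl// mulr1; exact: coth_ge_inv.
Qed.

(** With y = cosh r, the vector field slope^(p-1) grad r is
    [radial_field y] times grad (cosh r). *)
Definition radial_field y := slope (arcosh y) `^ (p - 1) / Num.sqrt (y ^+ 2 - 1).

Definition dradial_field y := let r := arcosh y in
  (p - 1) * slope r `^ (p - 2) * dslope r / (y ^+ 2 - 1)
  - slope r `^ (p - 1) * y / Num.sqrt (y ^+ 2 - 1) ^+ 3.

Lemma is_derive_radial_field y : 1 < y ->
  is_derive y 1 radial_field (dradial_field y).
Proof.
move=> y1; have r0 := arcosh_gt0 y1.
have h0 : 0 < y ^+ 2 - 1 by nra.
have s0 : 0 < Num.sqrt (y ^+ 2 - 1) by rewrite sqrtr_gt0.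
have sn : Num.sqrt (y ^+ 2 - 1) != 0 by rewrite gt_eqF.
have h1 : is_derive y 1 (fun z : R => z ^+ 2 - 1) (2 * y).
  by apply: is_derive_eq; rewrite /GRing.scale /=; ring.
have h2 := @is_derive1_comp R Num.sqrt (fun z => z ^+ 2 - 1) y _ _
  (is_derive1_sqrt h0) h1.
have h3 := @is_deriveV R _ y _ 1 sn h2.
have h4 := @is_derive1_comp R slope arcosh y _ _ (is_derive_slope r0)
  (is_derive_arcosh y1).
have h5 := @is_derive1_comp R (fun z => z `^ (p - 1)) (slope \o arcosh) y _ _
  (is_derive1_powR (p - 1) (slope_gt0 r0)) h4.
have -> : dradial_field y =
   slope (arcosh y) `^ (p - 1) *
     (- Num.sqrt (y ^+ 2 - 1) ^- 2 *: ((2 * Num.sqrt (y ^+ 2 - 1))^-1 * (2 * y))) +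
   (Num.sqrt (y ^+ 2 - 1))^-1 * ((p - 1) * slope (arcosh y) `^ (p - 1 - 1) *
     (dslope (arcosh y) * (Num.sqrt (y ^+ 2 - 1))^-1)).
  rewrite /dradial_field /=; have -> : p - 1 - 1 = p - 2 by ring.
  have s2 : y ^+ 2 - 1 = Num.sqrt (y ^+ 2 - 1) ^+ 2 by rewrite sqr_sqrtr// ltW.
  by rewrite {1}s2 /GRing.scale /=; field.
exact: is_deriveM.
Qed.

(** The left-hand side is the hyperbolic divergence of the field: as
    |grad y|^2 = y^2 - 1 and the Laplacian of y is n y, the divergence of
    k(y) grad y is k'(y) (y^2 - 1) + n y k(y). *)
Lemma radial_field_div n y : 1 < y -> n = 1 + p * a ->
  dradial_field y * (y ^+ 2 - 1) + n * y * radial_field y =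
  slope (arcosh y) `^ (p - 2) *
  ((p - 1) * dslope (arcosh y) + p * a * coth (arcosh y) * slope (arcosh y)).
Proof.
move=> y1 ->; have r0 := arcosh_gt0 y1.
have h0 : 0 < y ^+ 2 - 1 by nra.
have s0 : 0 < Num.sqrt (y ^+ 2 - 1) by rewrite sqrtr_gt0.
have s2 : y ^+ 2 - 1 = Num.sqrt (y ^+ 2 - 1) ^+ 2 by rewrite sqr_sqrtr// ltW.
rewrite /dradial_field /radial_field /coth cosh_arcosh ?sinh_arcosh ?ltW//=.
have -> : slope (arcosh y) `^ (p - 1) = slope (arcosh y) `^ (p - 2) * slope (arcosh y).
  rewrite -[X in _ * X]powRr1 ?ltW ?slope_gt0//.
  by rewrite -gt0_powRD ?slope_gt0//; congr (_ `^ _); ring.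
rewrite [X in _ * X + _]s2 [X in _ / X - _]s2; field.
by rewrite gt_eqF.
Qed.

Lemma radial_field_ge0 y : 0 <= radial_field y.
Proof. by rewrite mulr_ge0 ?powR_ge0// invr_ge0 sqrtr_ge0. Qed.

End radial_weight.

(** * The cutoff and the p-th power *)

Section one_variable_calculus.
Context {R : realType}.
Implicit Types p x y z e : R.

Lemma is_derive1_continuous (f : R -> R) x d : is_derive x 1 f d ->
  {for x, continuous f}.
Proof. by case=> h _; apply/differentiable_continuous/derivable1_diffP. Qed.

Definition pos_part x := (x + `|x|) / 2.

Lemma pos_part_ge0 x : 0 <= pos_part x.
Proof. by rewrite divr_ge0// -[X in _ + X]opprK subr_ge0 lerNl -normrN ler_norm. Qed.

Lemma pos_part_id x : 0 <= x -> pos_part x = x.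
Proof. by move=> x0; rewrite /pos_part ger0_norm//; field. Qed.

Lemma pos_part_eq0 x : x <= 0 -> pos_part x = 0.
Proof. by move=> x0; rewrite /pos_part ler0_norm// subrr mul0r. Qed.

Lemma continuous_pos_part : continuous pos_part.
Proof.
move=> x; apply: cvgM; last exact: cvg_cst.
by apply: cvgD; [exact: cvg_id|exact: norm_continuous].
Qed.

Lemma is_derive_pos_part2 x :
  is_derive x 1 (fun z => pos_part z ^+ 2) (2 * pos_part x).
Proof.
have [x0|x0|->] := ltgtP x 0.
- rewrite pos_part_eq0 ?ltW// mulr0.
  apply: (@near_eq_is_derive _ _ _ (cst 0)).
  by near=> z; rewrite pos_part_eq0 ?expr0n// ltW//; near: z; exact: lt_nbhsl.
- rewrite pos_part_id ?ltW//.
  apply: (@near_eq_is_derive _ _ _ (fun z : R => z ^+ 2)).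
    by near=> z; rewrite pos_part_id// ltW//; near: z; exact: lt_nbhsr.
  by apply: is_derive_eq; rewrite /GRing.scale /=; ring.
  (* At 0 the difference quotient is pos_part itself, which is continuous. *)
- apply/is_derive1_caratheodory; exists pos_part; split.
  + move=> z; rewrite subr0 (pos_part_eq0 (lexx 0)) expr0n subr0.
    have [z0|/ltW z0] := leP z 0; first by rewrite pos_part_eq0// expr0n mul0r.
    by rewrite pos_part_id.
  + exact: continuous_pos_part.
  + by rewrite pos_part_eq0// mulr0.
Unshelve. all: by end_near. Qed.

Lemma continuous_powR_gt0 (f : R -> R) x p : 0 < f x -> {for x, continuous f} ->
  {for x, continuous (fun z => f z `^ p)}.
Proof.
move=> fx0 cf; apply: (@continuous_comp _ _ _ f (fun z => z `^ p)) => //.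
exact: is_derive1_continuous (is_derive1_powR p fx0).
Qed.

Definition dpow_abs p x := p * `|x| `^ (p - 2) * x.

Lemma continuous_dpow_abs p : 2 <= p -> continuous (dpow_abs p).
Proof.
move=> p2 x; have [->|x0] := eqVneq x 0; last first.
  apply: cvgM; last exact: cvg_id.
  apply: cvgM; first exact: cvg_cst.
  apply: continuous_powR_gt0; last exact: norm_continuous.
  by rewrite normr_gt0.
apply/cvgrPdist_le => /= e e0; near=> z.
rewrite /dpow_abs mulr0 sub0r normrN -mulrA normrM (@ger0_norm _ p); last lra.
have z1 : `|z| <= 1 by near: z; apply: (@nbhs0_le R R).
have ze : `|z| <= e / p.
  by near: z; apply: (@nbhs0_le R R); rewrite divr_gt0//; lra.
rewrite mulrC -ler_pdivlMr; last lra.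
apply: le_trans ze; rewrite normrM ler_piMl// ger0_norm ?powR_ge0//.
have [->|zn] := eqVneq z 0.
  have [->|pn] := eqVneq (p - 2) 0; first by rewrite powRr0.
  by rewrite normr0 powR0.
rewrite -[leRHS](powRr0 `|z|); apply: ger_powR; first by rewrite normr_gt0 zn.
lra.
Unshelve. all: by end_near. Qed.

Lemma is_derive_pow_abs p x : 2 <= p ->
  is_derive x 1 (fun z => `|z| `^ p) (dpow_abs p x).
Proof.
move=> p2; have powE (z : R) : z != 0 -> `|z| `^ p = `|z| `^ (p - 2) * z ^+ 2.
  move=> zn; rewrite -[z ^+ 2]ger0_norm ?sqr_ge0// normrX -powR_mulrn//.
  by rewrite -gt0_powRD ?normr_gt0// subrK.
have [->|x0] := eqVneq x 0.
  apply/is_derive1_caratheodory; exists (fun z => p^-1 * dpow_abs p z); split.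
  - move=> z; rewrite normr0 powR0 ?subr0; last by rewrite gt_eqF//; lra.
    have [->|zn] := eqVneq z 0.
      by rewrite normr0 powR0 ?mulr0// gt_eqF//; lra.
    by rewrite powE// /dpow_abs; field; rewrite gt_eqF//; lra.
  - by apply: cvgM; [exact: cvg_cst|exact: continuous_dpow_abs].
  - by rewrite /dpow_abs !mulr0.
(* Away from 0, |z|^p is the smooth function (z^2)^(p/2). *)
have sqE (z : R) : (z ^+ 2) `^ (p / 2) = `|z| `^ p.
  rewrite -[z ^+ 2]ger0_norm ?sqr_ge0// normrX -powR_mulrn// -powRrM.
  by congr (_ `^ _); field.
have x2 : 0 < x ^+ 2 by rewrite exprn_even_gt0.
have h1 : is_derive x 1 (fun z : R => z ^+ 2) (2 * x).
  by apply: is_derive_eq; rewrite /GRing.scale /=; ring.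
have := @is_derive1_comp R (fun z => z `^ (p / 2)) (fun z => z ^+ 2) x _ _
  (is_derive1_powR (p / 2) x2) h1.
have -> : (fun z => z `^ (p / 2)) \o (fun z : R => z ^+ 2) = (fun z => `|z| `^ p).
  by apply/funext => z /=; rewrite sqE.
suff -> : p / 2 * (x ^+ 2) `^ (p / 2 - 1) * (2 * x) = dpow_abs p x by [].
have -> : (x ^+ 2) `^ (p / 2 - 1) = `|x| `^ (p - 2).
  rewrite -[x ^+ 2]ger0_norm ?sqr_ge0// normrX -powR_mulrn// -powRrM.
  by congr (_ `^ _); field.
by rewrite /dpow_abs; field.
Qed.

(** In the variable y = cosh r. Vanishing near the pole y = 1, it makes the
    singular field C^1 across the pole; being nondecreasing in y, it adds a
    nonnegative term to the divergence. The square makes the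
    cutoff itself C^1. *)
Definition cutoff e y := pos_part (y - 1 - e) ^+ 2 / (y - 1) ^+ 2.

Definition dcutoff e y := 2 * pos_part (y - 1 - e) / (y - 1) ^+ 2
  - 2 * pos_part (y - 1 - e) ^+ 2 / (y - 1) ^+ 3.

Lemma pos_part_le e y : 0 <= e -> 1 <= y -> pos_part (y - 1 - e) <= y - 1.
Proof.
move=> e0 y1; have [h|/ltW h] := leP (y - 1 - e) 0; first by rewrite pos_part_eq0//; lra.
by rewrite pos_part_id//; lra.
Qed.

Lemma cutoff_ge0 e y : 0 <= cutoff e y.
Proof. by rewrite mulr_ge0 ?invr_ge0 ?sqr_ge0. Qed.

Lemma cutoff_le1 e y : 0 <= e -> 1 <= y -> cutoff e y <= 1.
Proof.
move=> e0; rewrite le_eqVlt => /predU1P[<-|y1].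
  by rewrite /cutoff subrr [X in _ / X]expr0n invr0 mulr0.
have h := pos_part_le e0 (ltW y1).
rewrite /cutoff ler_pdivrMr ?exprn_gt0 ?subr_gt0// mul1r.
by rewrite ler_pXn2r// nnegrE ?pos_part_ge0//; lra.
Qed.

Lemma dcutoff_ge0 e y : 0 <= e -> 1 < y -> 0 <= dcutoff e y.
Proof.
move=> e0 y1; have h := pos_part_le e0 (ltW y1); have m0 := pos_part_ge0 (y - 1 - e).
have -> : dcutoff e y =
    2 * pos_part (y - 1 - e) * (y - 1 - pos_part (y - 1 - e)) / (y - 1) ^+ 3.
  by rewrite /dcutoff; field; rewrite gt_eqF// subr_gt0.
by apply: divr_ge0; [apply: mulr_ge0; [apply: mulr_ge0|]|apply: exprn_ge0]; lra.
Qed.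

Lemma cutoff_nincr e e' y : 0 <= e -> e <= e' -> cutoff e' y <= cutoff e y.
Proof.
move=> e0 ee; rewrite /cutoff ler_wpM2r ?invr_ge0 ?sqr_ge0//.
rewrite ler_pXn2r// ?nnegrE ?pos_part_ge0//.
have [h|/ltW h] := leP (y - 1 - e') 0; first by rewrite pos_part_eq0// pos_part_ge0.
by rewrite !pos_part_id//; lra.
Qed.

Lemma is_derive_cutoff e y : 1 < y -> is_derive y 1 (cutoff e) (dcutoff e y).
Proof.
move=> y1; have yn : (y - 1) ^+ 2 != 0 by rewrite expf_neq0// gt_eqF// subr_gt0.
have h0 : is_derive y 1 (fun z => z - 1 - e) 1.
  by apply: is_derive_eq; rewrite !subr0.
have h1 := @is_derive1_comp R (fun z => pos_part z ^+ 2) (fun z => z - 1 - e) y _ _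
  (is_derive_pos_part2 (y - 1 - e)) h0.
have h2 : is_derive y 1 (fun z : R => (z - 1) ^+ 2) (2 * (y - 1)).
  by apply: is_derive_eq; rewrite /GRing.scale /=; ring.
have h3 := @is_deriveV R _ y _ 1 yn h2.
have -> : dcutoff e y =
  pos_part (y - 1 - e) ^+ 2 * (- ((y - 1) ^+ 2) ^- 2 *: (2 * (y - 1))) +
  ((y - 1) ^+ 2)^-1 * (2 * pos_part (y - 1 - e) * 1).
  by rewrite /dcutoff /GRing.scale /=; field; rewrite gt_eqF// subr_gt0.
exact: is_deriveM.
Qed.

Lemma cutoff_eq0 e y : y <= 1 + e -> cutoff e y = 0.
Proof. by move=> h; rewrite /cutoff pos_part_eq0 ?expr0n ?mul0r//; lra. Qed.

Lemma dcutoff_eq0 e y : y <= 1 + e -> dcutoff e y = 0.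
Proof.
by move=> h; rewrite /dcutoff pos_part_eq0 ?expr0n ?mulr0 ?mul0r ?subrr//; lra.
Qed.

Lemma is_derive_cutoffM e (k dk : R -> R) y : 0 < e ->
  (forall z, 1 < z -> is_derive z 1 k (dk z)) -> 1 <= y ->
  is_derive y 1 (fun z => cutoff e z * k z) (dcutoff e y * k y + cutoff e y * dk y).
Proof.
move=> e0 kd; rewrite le_eqVlt => /predU1P[<-|y1]; last first.
  apply: is_derive_eq; first exact: (is_deriveM (is_derive_cutoff e y1) (kd _ y1)).
  by rewrite /GRing.scale /=; ring.
rewrite cutoff_eq0 ?dcutoff_eq0 ?mul0r ?addr0; [|lra|lra].
apply: (@near_eq_is_derive _ _ _ (cst 0)).
near=> z; rewrite cutoff_eq0 ?mul0r// ltW//.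
by near: z; apply: lt_nbhsl; lra.
Unshelve. all: by end_near. Qed.

Lemma continuous_dcutoffM e (k dk : R -> R) y : 0 < e ->
  (forall z, 1 < z -> is_derive z 1 k (dk z)) ->
  (forall z, 1 < z -> {for z, continuous dk}) -> 1 <= y ->
  {for y, continuous (fun z => dcutoff e z * k z + cutoff e z * dk z)}.
Proof.
move=> e0 kd cdk; rewrite le_eqVlt => /predU1P[<-|y1]; last first.
  apply: cvgD; apply: cvgM.
  - have cp : {for y, continuous (fun z => pos_part (z - 1 - e))}.
      apply: (@continuous_comp _ _ _ (fun z => z - 1 - e) pos_part);
        last exact: continuous_pos_part.
      by apply: cvgB; [apply: cvgB; [exact: cvg_id|exact: cvg_cst]|exact: cvg_cst].
    have cy n : {for y, continuous (fun z : R => ((z - 1) ^+ n)^-1)}.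
      apply: cvgV; first by rewrite expf_neq0// gt_eqF// subr_gt0.
      apply: (@continuous_comp _ _ _ (fun z : R => z - 1) (fun z : R => z ^+ n)).
        by apply: cvgB; [exact: cvg_id|exact: cvg_cst].
      exact: exprn_continuous.
    rewrite /dcutoff; apply: cvgB; (apply: cvgM; last exact: cy).
      by apply: cvgM => //; exact: cvg_cst.
    apply: cvgM; first exact: cvg_cst.
    exact: (cvgM cp cp).
  - exact: is_derive1_continuous (kd _ y1).
  - exact: is_derive1_continuous (is_derive_cutoff e y1).
  - exact: cdk.
apply: (near_cst_continuous 0); near=> z.
have z1 : z <= 1 + e by rewrite ltW//; near: z; apply: lt_nbhsl; lra.
by rewrite cutoff_eq0 ?dcutoff_eq0 ?mul0r ?addr0.
Unshelve. all: by end_near. Qed.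

End one_variable_calculus.

(** * The Poincare ball *)

Section calculus_complements.
Context {R : realType}.

Lemma continuous_sum_ord (T : topologicalType) n (f : 'I_n -> T -> R) (x : T) :
  (forall i, {for x, continuous (f i)}) ->
  {for x, continuous (fun z => \sum_i f i z)}.
Proof.
move=> cf; have -> : (fun z => \sum_i f i z) = \sum_i f i.
  by apply/funext => z; rewrite fct_sumE.
elim/big_ind : _ => [|g h cg ch|i _]; [exact: cst_continuous| |exact: cf].
exact: continuousD.
Qed.

Section pointwise_continuity.
Variables (T : topologicalType) (x : T) (f g : T -> R).
Hypotheses (cf : {for x, continuous f}) (cg : {for x, continuous g}).

Lemma for_continuousD : {for x, continuous (fun z => f z + g z)}.
Proof. exact: continuousD. Qed.

Lemma for_continuousB : {for x, continuous (fun z => f z - g z)}.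
Proof. exact: (cvgB cf cg). Qed.

Lemma for_continuousM : {for x, continuous (fun z => f z * g z)}.
Proof. exact: continuousM. Qed.

Lemma for_continuousV : f x != 0 -> {for x, continuous (fun z => (f z)^-1)}.
Proof. by move=> fx0; exact: continuousV. Qed.

Lemma for_continuous_comp (h : R -> R) : {for f x, continuous h} ->
  {for x, continuous (fun z => h (f z))}.
Proof. by move=> ch; exact: continuous_comp. Qed.

Lemma for_continuousX n : {for x, continuous (fun z => f z ^+ n)}.
Proof. by apply: (for_continuous_comp (h := fun y => y ^+ n)); exact: exprn_continuous. Qed.

End pointwise_continuity.

Lemma for_continuous_cst (T : topologicalType) (x : T) (k : R) :
  {for x, continuous (fun=> k)}.
Proof. exact: cst_continuous. Qed.

Lemma is_derive_sum_ord n (f : 'I_n -> R -> R) (df : 'I_n -> R) (x : R) :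
  (forall i, is_derive x 1 (f i) (df i)) ->
  is_derive x 1 (fun z => \sum_i f i z) (\sum_i df i).
Proof.
move=> h; have -> : (fun z => \sum_i f i z) = \sum_i f i.
  by apply/funext => z; rewrite fct_sumE.
exact: is_derive_sum.
Qed.

Lemma FTC_segment (F f : R -> R) (a b : R) : a < b ->
  (forall t, a <= t <= b -> is_derive t 1 F (f t)) ->
  (forall t, a <= t <= b -> {for t, continuous f}) ->
  (\int[@lebesgue_measure R]_(x in `[a, b]) (f x)%:E = (F b)%:E - (F a)%:E)%E.
Proof.
move=> ab dF cf; have cF t : a <= t <= b -> {for t, continuous F}.
  by move=> /dF; exact: is_derive1_continuous.
apply: continuous_FTC2 => //.
- by apply: continuous_in_subspaceT => t; rewrite inE/= in_itv/=; exact: cf.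
- split.
  + move=> t; rewrite in_itv/= => /andP[/ltW at_ /ltW tb].
    by case: (dF t) => //; rewrite at_.
  + by apply: cvg_at_right_filter; apply: cF; rewrite lexx ltW.
  + by apply: cvg_at_left_filter; apply: cF; rewrite lexx ltW.
- move=> t; rewrite in_itv/= => /andP[/ltW at_ /ltW tb].
  by rewrite derive1E; case: (dF t) => //; rewrite at_.
Qed.

End calculus_complements.

Section poincare_geometry.
Context {R : realType} {N : nat}.
Implicit Types (x y z v w : 'rV[R]_N).

Definition dotp x y := \sum_i x 0 i * y 0 i.
Definition sqn x := \sum_i x 0 i ^+ 2.
Definition gap x := 1 - sqn x.

Lemma sqn_ge0 x : 0 <= sqn x.
Proof. by apply: sumr_ge0 => i _; rewrite sqr_ge0. Qed.

Lemma dotpC x y : dotp x y = dotp y x.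
Proof. by apply: eq_bigr => i _; rewrite mulrC. Qed.

Lemma dotpZl (k : R) x y : dotp (k *: x) y = k * dotp x y.
Proof. by rewrite /dotp mulr_sumr; apply: eq_bigr => i _; rewrite mxE mulrA. Qed.

Lemma dotpDl x y z : dotp (x + y) z = dotp x z + dotp y z.
Proof. by rewrite /dotp -big_split; apply: eq_bigr => i _; rewrite mxE mulrDl. Qed.

Lemma dotpBl x y z : dotp (x - y) z = dotp x z - dotp y z.
Proof. by rewrite -scaleN1r dotpDl dotpZl mulN1r. Qed.

Lemma dotpDr x y z : dotp z (x + y) = dotp z x + dotp z y.
Proof. by rewrite dotpC dotpDl !(dotpC z). Qed.

Lemma dotpBr x y z : dotp z (x - y) = dotp z x - dotp z y.
Proof. by rewrite dotpC dotpBl !(dotpC z). Qed.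

Lemma dotpZr (k : R) x y : dotp x (k *: y) = k * dotp x y.
Proof. by rewrite dotpC dotpZl dotpC. Qed.

Lemma sqnE x : sqn x = dotp x x.
Proof. by apply: eq_bigr => i _; rewrite expr2. Qed.

Definition dotp_simp := (sqnE, dotpBl, dotpBr, dotpDl, dotpDr, dotpZl, dotpZr).

Lemma sqnZ (k : R) x : sqn (k *: x) = k ^+ 2 * sqn x.
Proof. by rewrite !dotp_simp expr2 mulrA. Qed.

Lemma sqn_eq0 x : sqn x = 0 -> x = 0.
Proof.
move=> /eqP; rewrite psumr_eq0; last by move=> i _; exact: sqr_ge0.
move=> /allP h; apply/rowP => i; rewrite mxE; apply/eqP.
by rewrite -sqrf_eq0; apply: h; rewrite mem_index_enum.
Qed.

Lemma dotp_cauchy x y : dotp x y ^+ 2 <= sqn x * sqn y.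
Proof.
have [y0|yn] := eqVneq (sqn y) 0.
  by rewrite y0 mulr0 (sqn_eq0 y0) -(scale0r 0) dotpZr mul0r expr0n.
have y0 : 0 < sqn y by rewrite lt_neqAle eq_sym yn sqn_ge0.
have := sqn_ge0 (sqn y *: x - dotp x y *: y).
have -> : sqn (sqn y *: x - dotp x y *: y) = sqn y * (sqn x * sqn y - dotp x y ^+ 2).
  by rewrite !dotp_simp (dotpC y x); ring.
by rewrite pmulr_rge0// subr_ge0.
Qed.

Lemma ler_dotp x y : `|dotp x y| <= Num.sqrt (sqn x) * Num.sqrt (sqn y).
Proof.
by rewrite -sqrtrM ?sqn_ge0// -sqrtr_sqr ler_wsqrtr// dotp_cauchy.
Qed.

Lemma hyp_spaceE x : hyp_space x <-> 0 < gap x.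
Proof. by rewrite /hyp_space /= /gap subr_gt0. Qed.

Lemma riem_normE x v : 0 < gap x -> riem_norm x v = 2 / gap x * Num.sqrt (sqn v).
Proof.
move=> g0; rewrite /riem_norm /hyp_metric -scalemx1 -scalemxAr mulmx1 -scalemxAl mxE.
rewrite [X in _ * X]mxE -/(gap x) sqrtrM ?sqr_ge0//.
rewrite sqrtr_sqr ger0_norm ?divr_ge0 ?ltW//; congr (_ * Num.sqrt _).
by apply: eq_bigr => i _; rewrite mxE expr2.
Qed.

(** The closed formula for cosh r in the ball model, where r is the distance
    from x0 to x. *)
Definition cosh_dist (x0 x : 'rV[R]_N) := 1 + 2 * sqn (x - x0) / (gap x * gap x0).

(** The Euclidean gradient of cosh_dist x0. *)
Definition grad_cosh x0 x : 'rV[R]_N :=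
  (4 / (gap x0 * gap x ^+ 2)) *: (gap x *: (x - x0) + sqn (x - x0) *: x).

Lemma cosh_dist_ge1 x0 x : 0 < gap x0 -> 0 < gap x -> 1 <= cosh_dist x0 x.
Proof.
by move=> g0 g; rewrite lerDl divr_ge0 ?mulr_ge0 ?sqn_ge0// ltW.
Qed.

Lemma cosh_dist_gt1 x0 x : 0 < gap x0 -> 0 < gap x -> x != x0 -> 1 < cosh_dist x0 x.
Proof.
move=> g0 g xx0; rewrite ltrDl divr_gt0 ?mulr_gt0//.
rewrite lt_neqAle sqn_ge0 andbT eq_sym; apply: contra xx0 => /eqP /sqn_eq0 /eqP.
by rewrite subr_eq0.
Qed.

Lemma cosh_dist_refl x0 : cosh_dist x0 x0 = 1.
Proof.
by rewrite /cosh_dist subrr !dotp_simp -(scale0r 0) dotpZl !mul0r mulr0 mul0r addr0.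
Qed.

(** The eikonal equation |grad r| = 1, in the form |grad cosh r| = sinh r; the
    factor (2 / gap x)^2 converts Euclidean into hyperbolic norms of covectors.
    The three inner products reduce to gap x, gap x0 and |x - x0|^2. *)
Lemma sqn_grad_cosh x0 x : 0 < gap x0 -> 0 < gap x ->
  sqn (grad_cosh x0 x) = (2 / gap x) ^+ 2 * (cosh_dist x0 x ^+ 2 - 1).
Proof.
move=> g0 g; have gn : gap x != 0 by rewrite gt_eqF.
have g0n : gap x0 != 0 by rewrite gt_eqF.
rewrite /grad_cosh /cosh_dist sqnZ.
have -> : sqn (gap x *: (x - x0) + sqn (x - x0) *: x) =
  gap x ^+ 2 * sqn (x - x0) + 2 * gap x * sqn (x - x0) * (sqn x - dotp x x0) +
  sqn (x - x0) ^+ 2 * sqn x.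
  by rewrite !dotp_simp (dotpC x0 x); ring.
have D : sqn (x - x0) = sqn x + sqn x0 - 2 * dotp x x0.
  by rewrite !dotp_simp (dotpC x0 x); ring.
have -> : sqn x = 1 - gap x by rewrite /gap; ring.
have -> : dotp x x0 = (2 - gap x - gap x0 - sqn (x - x0)) / 2.
  by rewrite D /gap; field.
by field; rewrite gn g0n.
Qed.

Section along_a_curve.
Variables (c : R -> 'rV[R]_N) (t : R) (dc : 'rV[R]_N).
Hypothesis cd : forall i, is_derive t 1 (fun s => c s 0 i) (dc 0 i).

Lemma is_derive_sqn : is_derive t 1 (fun s => sqn (c s)) (2 * dotp (c t) dc).
Proof.
rewrite /dotp mulr_sumr; apply: is_derive_sum_ord => i.
by have ? := cd i; apply: is_derive_eq; rewrite /GRing.scale /=; ring.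
Qed.

Lemma is_derive_gap : is_derive t 1 (fun s => gap (c s)) (- (2 * dotp (c t) dc)).
Proof. by have ? := is_derive_sqn; apply: is_derive_eq; rewrite sub0r. Qed.

End along_a_curve.

Lemma is_derive_cosh_dist x0 (c : R -> 'rV[R]_N) (t : R) (dc : 'rV[R]_N) :
  (forall i, is_derive t 1 (fun s => c s 0 i) (dc 0 i)) ->
  0 < gap x0 -> 0 < gap (c t) ->
  is_derive t 1 (fun s => cosh_dist x0 (c s)) (dotp (grad_cosh x0 (c t)) dc).
Proof.
move=> cd g0 g; have gn : gap (c t) != 0 by rewrite gt_eqF.
have g0n : gap x0 != 0 by rewrite gt_eqF.
have h1 : is_derive t 1 (fun s => sqn (c s - x0)) (2 * dotp (c t - x0) dc).
  apply: is_derive_sqn => i; have ? := cd i.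
  have -> : (fun s => (c s - x0) 0 i) = (fun s => c s 0 i - x0 0 i).
    by apply/funext => s; rewrite !mxE.
  by apply: is_derive_eq; rewrite subr0.
have h2 := @is_deriveV R (fun s => gap (c s)) t _ 1 gn (is_derive_gap cd).
have -> : (fun s => cosh_dist x0 (c s)) =
    (fun s => 1 + (2 / gap x0) * (sqn (c s - x0) * (gap (c s))^-1)).
  by apply/funext => s; rewrite /cosh_dist invfM; ring.
apply: is_derive_eq; rewrite /GRing.scale /=.
have -> : dotp (grad_cosh x0 (c t)) dc = 4 / (gap x0 * gap (c t) ^+ 2) *
    (gap (c t) * dotp (c t - x0) dc + sqn (c t - x0) * dotp (c t) dc).
  by rewrite /grad_cosh dotpZl (dotpDl (_ *: _)) !dotpZl.
field.
by rewrite g0n gn.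
Qed.

Lemma for_continuous_coord x i : {for x, continuous (fun z : 'rV[R]_N => z 0 i)}.
Proof. exact: coord_continuous. Qed.

Lemma continuous_sqnB x0 : continuous (fun x => sqn (x - x0)).
Proof.
have -> : (fun x => sqn (x - x0)) = (fun x => \sum_i (x 0 i - x0 0 i) ^+ 2).
  by apply/funext => x; apply: eq_bigr => i _; rewrite !mxE.
move=> x; apply: continuous_sum_ord => i; apply: for_continuousX.
by apply: for_continuousB; [exact: for_continuous_coord|exact: for_continuous_cst].
Qed.

Lemma continuous_gap : continuous (fun x => gap x).
Proof.
move=> x; apply: for_continuousB; first exact: for_continuous_cst.
apply: continuous_sum_ord => i; apply: for_continuousX; exact: for_continuous_coord.
Qed.

Lemma continuous_cosh_dist x0 x : 0 < gap x0 -> 0 < gap x ->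
  {for x, continuous (cosh_dist x0)}.
Proof.
move=> g0 g; apply: for_continuousD; first exact: for_continuous_cst.
apply: for_continuousM.
  by apply: for_continuousM; [exact: for_continuous_cst|exact: continuous_sqnB].
apply: for_continuousV; last by rewrite mulf_neq0// gt_eqF.
by apply: for_continuousM; [exact: continuous_gap|exact: for_continuous_cst].
Qed.

Lemma continuous_grad_cosh x0 x i : 0 < gap x0 -> 0 < gap x ->
  {for x, continuous (fun z => grad_cosh x0 z 0 i)}.
Proof.
move=> g0 g.
have -> : (fun z => grad_cosh x0 z 0 i) =
  (fun z => 4 / (gap x0 * gap z ^+ 2) * (gap z * (z 0 i - x0 0 i) + sqn (z - x0) * z 0 i)).
  by apply/funext => z; rewrite !mxE.
have cgap := @continuous_gap x; have ccoord := @for_continuous_coord x i.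
have ccst := @for_continuous_cst _ 'rV[R]_N x.
apply: for_continuousM.
  apply: for_continuousM => //.
  apply: for_continuousV; last by rewrite mulf_neq0 ?expf_neq0// gt_eqF.
  by apply: for_continuousM => //; exact: for_continuousX.
apply: for_continuousD; apply: for_continuousM => //.
- exact: for_continuousB.
- exact: continuous_sqnB.
Qed.

End poincare_geometry.

(** * A lower bound for the geodesic distance *)

Section distance_lower_bound.
Context {R : realType} {N : nat}.
Implicit Types (x y z v w : 'rV[R]_N) (t : R).

Lemma is_derive_coord (c : R -> 'rV[R]_N) t : derivable c t 1 ->
  forall i, is_derive t 1 (fun s => c s 0 i) (derive1 c t 0 i).
Proof.
move=> cd i; have cdi := (derivable_mxP c t 1).1 cd 0 i.
by rewrite derive1E derive_mx// mxE; exact: derivableP.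
Qed.

Lemma sqn_segment x y (t : R) : 0 <= t <= 1 ->
  sqn (x + t *: (y - x)) <= (1 - t) * sqn x + t * sqn y.
Proof.
move=> /andP[t0 t1]; rewrite -subr_ge0.
have -> : (1 - t) * sqn x + t * sqn y - sqn (x + t *: (y - x)) =
   t * (1 - t) * sqn (x - y) by rewrite !dotp_simp (dotpC y x); ring.
by rewrite mulr_ge0 ?sqn_ge0// mulr_ge0// subr_ge0.
Qed.

Definition segment_curve x y (t : R) : 'rV[R]_N := x + t *: (y - x).

Lemma hyp_curve_segment x y : 0 < gap x -> 0 < gap y ->
  hyp_curve x y (segment_curve x y).
Proof.
move=> gx gy; have cd i (t : R) :
    is_derive t 1 (fun s => (x + s *: (y - x)) 0 i) ((y - x) 0 i).
  have -> : (fun s => (x + s *: (y - x)) 0 i) = (fun s => x 0 i + s * (y - x) 0 i).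
    by apply/funext => s; rewrite !mxE.
  by apply: is_derive_eq; rewrite /GRing.scale /=; ring.
have cder (t : R) : derivable (segment_curve x y) t 1.
  by apply/derivable_mxP => i j; rewrite (ord1 i); case: (cd j t).
split.
- by rewrite /segment_curve scale0r addr0.
- by rewrite /segment_curve scale1r addrC subrK.
- exact: cder.
- have -> : derive1 (segment_curve x y) = cst (y - x).
    apply/funext => t; apply/rowP => i.
    have := is_derive_coord (cder t) i; have := cd i t.
    by case=> _ <- [_ <-].
  exact: cst_continuous.
- move=> t t01; apply/hyp_spaceE; rewrite /gap subr_gt0.
  apply: le_lt_trans (sqn_segment x y t01) _.
  move: gx gy t01; rewrite /gap !subr_gt0 => gx gy /andP[t0 t1].
  have [->|tn] := eqVneq t 0; first by rewrite subr0 mul1r mul0r addr0.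
  have t_gt0 : 0 < t by rewrite lt_neqAle eq_sym tn.
  have : t * sqn y < t by rewrite gtr_pMr.
  have : (1 - t) * sqn x <= 1 - t by rewrite ler_piMr ?subr_ge0// ltW.
  by move=> ? ?; lra.
Qed.

Lemma riem_norm_ge0 x v : 0 <= riem_norm x v.
Proof. exact: sqrtr_ge0. Qed.

Section lower_bound.
Variables (x0 x : 'rV[R]_N).
Hypotheses (g0 : 0 < gap x0) (g : 0 < gap x).

(** Along a curve, arcosh (q + d) with q = cosh_dist varies at most by the
    length, as the hyperbolic gradient of q has norm sqrt (q^2 - 1). The shift
    d > 0 keeps arcosh away from its singularity at 1; with d = cosh e - 1 its
    contribution at the end point x0 is exactly e. *)
Lemma arcosh_le_curve_length (c : R -> 'rV[R]_N) : hyp_curve x x0 c ->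
  arcosh (cosh_dist x0 x) <= curve_length c.
Proof.
move=> [c0 c1 cder cdc cU]; apply/ler_addgt0Pr => e e0.
have d0 : 0 < cosh e - 1 by rewrite subr_gt0 cosh_gt1.
set d := cosh e - 1 in d0.
have U t : 0 <= t <= 1 -> 0 < gap (c t) by move=> /cU /hyp_spaceE.
pose q t := cosh_dist x0 (c t).
pose s t := Num.sqrt ((q t + d) ^+ 2 - 1).
pose dq t := dotp (grad_cosh x0 (c t)) (derive1 c t).
have q1 t : 0 <= t <= 1 -> 1 <= q t by move=> /U; exact: cosh_dist_ge1.
have s0 t : 0 <= t <= 1 -> 0 < s t by move=> /q1 h; rewrite sqrtr_gt0; nra.
have dF t : 0 <= t <= 1 -> is_derive t 1 (fun t : R => - arcosh (q t + d)) (- (dq t / s t)).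
  move=> t01; have h1 : is_derive t 1 q (dq t).
    by apply: is_derive_cosh_dist; [exact: is_derive_coord| |exact: U].
  have h2 : is_derive t 1 (fun t : R => q t + d) (dq t).
    by apply: is_derive_eq; rewrite addr0.
  have h3 : 1 < q t + d by have := q1 _ t01; lra.
  have h4 := @is_derive1_comp R (@arcosh R) (fun t => q t + d) t _ _
    (is_derive_arcosh h3) h2.
  by rewrite mulrC; exact: is_deriveN.
have cc : continuous c.
  by move=> t; apply/differentiable_continuous/derivable1_diffP.
have cci t i : {for t, continuous (fun t => c t 0 i)}.
  apply: (@continuous_comp _ _ _ c (fun z : 'rV[R]_N => z 0 i)); first exact: cc.
  exact: coord_continuous.
have cdci t i : {for t, continuous (fun t => derive1 c t 0 i)}.
  apply: (@continuous_comp _ _ _ (derive1 c) (fun z : 'rV[R]_N => z 0 i)).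
    exact: cdc.
  exact: coord_continuous.
have cdq t : 0 <= t <= 1 -> {for t, continuous dq}.
  move=> t01; apply: continuous_sum_ord => i; apply: for_continuousM; last exact: cdci.
  apply: (@continuous_comp _ _ _ c (fun z => grad_cosh x0 z 0 i)); first exact: cc.
  by apply: continuous_grad_cosh => //; exact: U.
have cq t : 0 <= t <= 1 -> {for t, continuous q}.
  move=> t01; apply: (@continuous_comp _ _ _ c); first exact: cc.
  by apply: continuous_cosh_dist => //; exact: U.
have cs t : 0 <= t <= 1 -> {for t, continuous s}.
  move=> t01; apply: (@for_continuous_comp R _ _ _ _ Num.sqrt); last exact: sqrt_continuous.
  apply: for_continuousB; last exact: for_continuous_cst.
  apply: for_continuousX; apply: for_continuousD; [exact: cq|exact: for_continuous_cst].
have cf t : 0 <= t <= 1 -> {for t, continuous (fun t : R => - (dq t / s t))}.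
  move=> t01; apply: continuousN; apply: for_continuousM; first exact: cdq.
  by apply: for_continuousV; [exact: cs|rewrite gt_eqF ?s0].
pose L t := 2 / gap (c t) * Num.sqrt (sqn (derive1 c t)).
have cL t : 0 <= t <= 1 -> {for t, continuous L}.
  move=> t01; apply: for_continuousM.
    apply: for_continuousM; first exact: for_continuous_cst.
    apply: for_continuousV; last by rewrite gt_eqF ?U.
    apply: (@continuous_comp _ _ _ c); [exact: cc|exact: continuous_gap].
  apply: (@for_continuous_comp R _ _ _ _ Num.sqrt); last exact: sqrt_continuous.
  by apply: continuous_sum_ord => i; apply: for_continuousX; exact: cdci.
have -> : curve_length c = \int[@lebesgue_measure R]_(t in `[0, 1]) L t.
  apply: eq_Rintegral => t; rewrite inE/= in_itv/= => t01.
  by rewrite riem_normE ?U.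
have int_of h : (forall t, 0 <= t <= 1 -> {for t, continuous h}) ->
    (@lebesgue_measure R).-integrable `[0, 1] (EFin \o (h : R -> R)).
  move=> ch; apply: continuous_compact_integrable; first exact: segment_compact.
  by apply: continuous_in_subspaceT => t; rewrite inE/= in_itv/=; exact: ch.
have FTC : \int[@lebesgue_measure R]_(t in `[0, 1]) (- (dq t / s t)) =
    arcosh (q 0 + d) - arcosh (q 1 + d).
  by rewrite /Rintegral (FTC_segment ltr01 dF cf) -EFinB/= opprK addrC.
have -> : arcosh (cosh_dist x0 x) = arcosh (q 0) by rewrite /q c0.
have e1 : arcosh (q 1 + d) = e.
  by rewrite /q c1 cosh_dist_refl /d addrC subrK coshK// ltW.
apply: (@le_trans _ _ (arcosh (q 0 + d))).
  by apply: ler_arcosh; [apply: q1; rewrite lexx ler01|rewrite lerDl ltW].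
rewrite -lerBlDr -[X in _ - X]e1 -FTC; apply: le_Rintegral => //.
- exact: int_of.
- exact: int_of.
move=> t; rewrite /= in_itv/= => t01.
have gt := U _ t01; have q1t := q1 _ t01; have s0t := s0 _ t01.
rewrite -mulNr ler_pdivrMr//; apply: le_trans (ler_norm _) _; rewrite normrN.
apply: le_trans (ler_dotp _ _) _.
have rho0 : 0 <= 2 / gap (c t) by rewrite divr_ge0// ltW.
rewrite sqn_grad_cosh// sqrtrM ?sqr_ge0// sqrtr_sqr ger0_norm//.
have -> : L t * s t = 2 / gap (c t) * s t * Num.sqrt (sqn (derive1 c t)).
  by rewrite /L mulrAC.
rewrite ler_wpM2r ?sqrtr_ge0// ler_wpM2l//.
by rewrite ler_wsqrtr// lerD2r; rewrite -/(q t); nra.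
Qed.

(** The weights 1/r^p and 1/sinh^p r decrease with r, so this lower bound for
    the distance bounds the right-hand side of the theorem from above. The
    infimum is over a nonempty set, as the ball is convex. *)
Lemma arcosh_le_geodesic_dist : arcosh (cosh_dist x0 x) <= geodesic_dist x x0.
Proof.
apply: lb_le_inf.
  exists (curve_length (segment_curve x x0)); exists (segment_curve x x0) => //.
  exact: hyp_curve_segment.
by move=> _ [c cP <-]; exact: arcosh_le_curve_length.
Qed.

End lower_bound.

Lemma geodesic_dist_refl x0 : 0 < gap x0 -> geodesic_dist x0 x0 = 0.
Proof.
move=> g0; apply/eqP; rewrite eq_le; apply/andP; split; last first.
  by have := arcosh_le_geodesic_dist g0 g0; rewrite cosh_dist_refl arcosh1.
have segE : segment_curve x0 x0 = cst x0.
  by apply/funext => s; rewrite /segment_curve subrr scaler0 addr0.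
have cst_len : curve_length (segment_curve x0 x0) = 0.
  rewrite /curve_length (_ : (fun t : R => _) = cst 0) ?Rintegral_cst// ?mul0r//.
  by apply/funext => t; rewrite segE derive1_cst /riem_norm !mul0mx mxE sqrtr0.
rewrite -{1}cst_len; apply: ge_inf.
  exists 0 => _ [c _ <-]; apply: Rintegral_ge0 => t _; exact: riem_norm_ge0.
by exists (segment_curve x0 x0) => //; exact: hyp_curve_segment.
Qed.

End distance_lower_bound.

(** * Integration of coordinate derivatives over R^n *)

Section tuple_integration.
Context {R : realType}.
Local Notation RR := (measurableTypeR R).

Definition row_of_tuple n (t : n.-tuple RR) : 'rV[R]_n := \row_i (tnth t i : R).

(** An open set of row vectors is a countable union of rational boxes, so the
    product sigma-algebra on tuples contains it. *)
Lemma measurable_open_row n (O : set 'rV[R]_n) : open O ->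
  measurable [set t : n.-tuple RR | O (row_of_tuple t)].
Proof.
move=> oO.
pose box (q : {ffun 'I_n -> rat * rat}) := [set t : n.-tuple RR |
  forall i, (tnth t i : R) \in `](ratr (q i).1), (ratr (q i).2)[].
pose good q := forall t : n.-tuple RR, box q t -> O (row_of_tuple t).
have mbox q : measurable (box q).
  have -> : box q = \bigcap_(i in [set: 'I_n])
      ((fun t : n.-tuple RR => tnth t i) @^-1` `](ratr (q i).1 : R), (ratr (q i).2)[).
    by apply/seteqP; split => [t h i _|t h i]; [exact: h|exact: (h i I)].
  apply: fin_bigcap_measurable => [|i _]; first exact: finite_finset.
  rewrite -[X in measurable X]setTI; apply: measurable_tnth => //.
have -> : [set t : n.-tuple RR | O (row_of_tuple t)] =
    \bigcup_q (if pselect (good q) then box q else set0).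
  apply/seteqP; split => [t Ot|t [q _]]; last by case: pselect => // gq; exact: gq.
  have /nbhs_ballP[e /= e0 eO] := open_nbhs_nbhs (conj oO Ot).
  have hq i : exists q : rat * rat, [/\
      (tnth t i : R) - e < ratr q.1, ratr q.1 < (tnth t i : R),
      (tnth t i : R) < ratr q.2 & ratr q.2 < (tnth t i : R) + e].
    have [|a] := @rat_in_itvoo R ((tnth t i : R) - e) (tnth t i : R).
      by rewrite gtrBl.
    have [|b] := @rat_in_itvoo R (tnth t i : R) ((tnth t i : R) + e).
      by rewrite ltrDl.
    rewrite !in_itv/= => /andP[b1 b2] /andP[a1 a2]; by exists (a, b).
  have [q qP] := choice hq.
  exists [ffun i => q i] => //; case: pselect => [gq|ngq].
    by move=> i; rewrite in_itv/= ffunE; have [_ -> ->] := qP i.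
  exfalso; apply: ngq => s sbox; apply: eO; split => // i j.
  rewrite !mxE /ball/= ltr_norml.
  have := sbox j; rewrite in_itv/= ffunE; have [h1 h2 h3 h4] := qP j.
  move=> /andP[h5 h6]; apply/andP; split; lra.
apply: countable_bigcupT_measurable => [|q]; first exact: countableP.
by case: pselect => [gq|ngq]; [exact: mbox|exact: measurable0].
Qed.

Lemma measurable_continuous_row n (f : 'rV[R]_n -> R) : continuous f ->
  measurable_fun setT (fun t : n.-tuple RR => f (row_of_tuple t)).
Proof.
move=> /continuousP cf; apply: (measurability _ (RGenOpens.measurableE R)).
move=> _ [_ [a [b ->] <-]]; rewrite setTI.
by apply: (measurable_open_row (O := f @^-1` `]a, b[)); apply: cf; exact: interval_open.
Qed.

Definition cube n : set (n.-tuple RR) :=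
  [set t | forall i, (tnth t i : R) \in `[(-2), 2]].

Lemma cubeS n (a : RR) (t : n.-tuple RR) :
  cube (cons_pair (a, t)) <-> (a : R) \in `[(-2 : R), 2] /\ cube t.
Proof.
split=> [h|[ha ht] i].
- split; first by have := h ord0.
  by move=> i; have := h (lift ord0 i); rewrite tnthS.
- by case: (unliftP ord0 i) => [j ->|->]; rewrite ?tnthS ?tnth0//; exact: ht.
Qed.

Lemma measurable_cube n : measurable (@cube n).
Proof.
have -> : @cube n = \bigcap_(i in [set: 'I_n])
    ((fun t : n.-tuple RR => tnth t i) @^-1` `[(-2 : R), 2]).
  by apply/seteqP; split => [t h i _|t h i]; [exact: h|exact: (h i I)].
apply: fin_bigcap_measurable => [|i _]; first exact: finite_finset.
rewrite -[X in measurable X]setTI; apply: measurable_tnth => //.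
Qed.

Lemma cube_fin n : (lebesgue_tuple (@cube n) < +oo)%E.
Proof.
elim: n => [|n IH]; first by rewrite /= diracE; case: (_ \in _); rewrite ltry.
rewrite /= /pushforward.
have -> : (@cons_pair _ RR n) @^-1` (@cube n.+1) = `[(-2 : R), 2] `*` (@cube n).
  by apply/seteqP; split => -[a t] /= h; [apply/cubeS|apply/cubeS].
rewrite (product_measure1E (@lebesgue_measure R) (@lebesgue_tuple R n)) //;
  last exact: measurable_cube.
have m2 : @lebesgue_measure R `[(-2 : R), 2] = 4%:E.
  by rewrite lebesgue_measure_itv/= ifT ?lte_fin; [rewrite -EFinD; congr EFin; ring|lra].
by move: m2 => /= ->; rewrite lte_mul_pinfty.
Qed.

Lemma integrable_cube d (T : measurableType d) (mu : {measure set T -> \bar R})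
    (A : set T) (f : T -> R) (M : R) :
  measurable A -> (mu A < +oo)%E -> measurable_fun setT f ->
  (forall x, `|f x| <= M) -> (forall x, ~ A x -> f x = 0) ->
  mu.-integrable setT (EFin \o f).
Proof.
move=> mA muA mf fM f0.
have -> : EFin \o f = (EFin \o f) \_ A.
  apply/funext => x; rewrite patchE; case: ifPn => // /negP xA /=.
  by rewrite f0// => Ax; apply: xA; rewrite inE.
apply/(integrable_mkcond _ mA); apply: measurable_bounded_integrable => //.
  exact: measurable_funTS.
exists M; split; first exact: num_real.
by move=> y My x _ /=; apply: le_trans (fM x) _; exact: ltW.
Qed.

Definition upd n (t : n.-tuple RR) (i : 'I_n) (a : R) : n.-tuple RR :=
  [tuple if j == i then a else tnth t j | j < n].

Lemma upd0 n (b a : RR) (t : n.-tuple RR) :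
  upd (cons_pair (b, t)) ord0 a = cons_pair (a, t).
Proof.
apply: eq_from_tnth => j; rewrite tnth_mktuple.
by case: (unliftP ord0 j) => [k ->|->]; rewrite ?eqxx ?tnth0//= !tnthS.
Qed.

Lemma updS n (b a : RR) (t : n.-tuple RR) (i : 'I_n) :
  upd (cons_pair (b, t)) (lift ord0 i) a = cons_pair (b, upd t i a).
Proof.
apply: eq_from_tnth => j; rewrite tnth_mktuple.
case: (unliftP ord0 j) => [k ->|->]; rewrite ?tnth0//= !tnthS.
by rewrite tnth_mktuple (inj_eq lift_inj).
Qed.

(** Fubini's theorem along the i-th axis. By induction on the dimension, as the
    measure is an iterated product: the first coordinate is integrated first if
    i = 0, and last otherwise. *)
Lemma integral_lines_eq0 n (i : 'I_n) (f : n.-tuple RR -> R) (M : R) :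
  measurable_fun setT f -> (forall t, `|f t| <= M) ->
  (forall t, ~ cube t -> f t = 0) ->
  (forall t, (\int[@lebesgue_measure R]_a (f (upd t i a))%:E = 0)%E) ->
  (\int[@lebesgue_tuple R n]_t (f t)%:E = 0)%E.
Proof.
elim: n i f => [[]//|n IH] i f mf fM f0 fl.
have mcons := @measurable_cons_pair _ RR n.
pose A := `[(-2 : R), 2]%classic `*` @cube n.
have mA : measurable A.
  by apply: measurableX; [exact: measurable_itv|exact: measurable_cube].
have muA : ((@lebesgue_measure R \x @lebesgue_tuple R n) A < +oo)%E.
  have := cube_fin n.+1; rewrite /= /pushforward.
  have -> // : (@cons_pair _ RR n) @^-1` (@cube n.+1) = A.
  by apply/seteqP; split => -[a t] /= h; [apply/cubeS|apply/cubeS].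
pose g (z : RR * n.-tuple RR) := f (cons_pair z).
have mg : measurable_fun setT g by exact: measurableT_comp.
pose m1 : {sigma_finite_measure set RR -> \bar R} := @lebesgue_measure R.
pose m2 : {sigma_finite_measure set n.-tuple RR -> \bar R} := @lebesgue_tuple R n.
pose mu : {measure set (RR * n.-tuple RR) -> \bar R} := (m1 \x m2)%E.
have ig : (@lebesgue_measure R \x @lebesgue_tuple R n)%E.-integrable setT (EFin \o g).
  apply: (@integrable_cube _ _ mu A g M) => //.
    by move=> z; exact: fM.
  by move=> [a t] nA; apply: f0 => /cubeS.
have -> : (\int[@lebesgue_tuple R n.+1]_t (f t)%:E =
    \int[@lebesgue_measure R \x @lebesgue_tuple R n]_z (g z)%:E)%E.
  transitivity (\int[pushforward (@lebesgue_measure R \x @lebesgue_tuple R n)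
    (@cons_pair _ RR n)]_t (f t)%:E)%E; first by [].
  rewrite integral_pushforward//.
  exact/measurable_EFinP.
case: (unliftP ord0 i) => [j ij|i0].
- rewrite -(integral12_prod_meas1 ig); apply: integral0_eq => a _.
  rewrite /fubini_F; apply: (IH j (fun t => f (cons_pair (a, t)))) => //.
  + by apply: measurableT_comp => //; apply: measurableT_comp.
  + by move=> t nt; apply: f0 => /cubeS[].
  + move=> t; rewrite -(fl (cons_pair (a, t))) ij.
    by apply: eq_integral => b _; rewrite updS.
- rewrite -(integral21_prod_meas1 ig); apply: integral0_eq => t _.
  rewrite /fubini_G -(fl (cons_pair ((0 : R) : RR, t))) i0.
  by apply: eq_integral => b _; rewrite upd0.
Qed.

End tuple_integration.

(** * The divergence theorem for radial fields *)

Section lines.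
Context {R : realType} {N : nat}.
Local Notation RR := (measurableTypeR R).

Implicit Types (t : N.-tuple RR) (i j : 'I_N) (a h s : R).

Definition line (t : N.-tuple RR) (i : 'I_N) (a : R) : 'rV[R]_N :=
  row_of_tuple (upd t i a).

Lemma lineE t i a j : line t i a 0 j = if j == i then a else tnth t j.
Proof. by rewrite mxE tnth_mktuple. Qed.

Lemma line_shift t i a h : line t i (h + a) = h *: delta_mx 0 i + line t i a.
Proof.
apply/rowP => j; rewrite !mxE !tnth_mktuple eqxx /=.
by case: (j == i); rewrite ?mulr1 ?mulr0 ?add0r.
Qed.

Lemma is_derive_line_coord t i a j :
  is_derive a 1 (fun s => line t i s 0 j) ((delta_mx 0 i : 'rV[R]_N) 0 j).
Proof.
rewrite mxE eqxx /=; have [->|ji] := eqVneq j i.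
  have -> : (fun s => line t i s 0 i) = id by apply/funext => s; rewrite lineE eqxx.
  exact: is_derive_id.
have -> : (fun s => line t i s 0 j) = cst (tnth t j : R).
  by apply/funext => s; rewrite lineE (negbTE ji).
exact: is_derive_cst.
Qed.

Lemma is_derive_line (u : 'rV[R]_N -> R) t i a : derivable u (line t i a) (delta_mx 0 i) ->
  is_derive a 1 (fun s => u (line t i s)) ('D_(delta_mx 0 i) u (line t i a)).
Proof.
move=> du.
have E : (fun h : R =>
     h^-1 *: (((fun s => u (line t i s)) \o shift a) (h *: 1) - u (line t i a))) =
   (fun h : R => h^-1 *: ((u \o shift (line t i a)) (h *: delta_mx 0 i) - u (line t i a))).
  apply/funext => h /=; rewrite line_shift.
  by rewrite [h *: 1]mulr1.
split; first by rewrite /derivable E.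
by rewrite /derive E.
Qed.

Lemma continuous_line t i : continuous (line t i).
Proof.
move=> a; apply/differentiable_continuous/derivable1_diffP/derivable_mxP => k j.
by rewrite (ord1 k); case: (is_derive_line_coord t i a j).
Qed.

End lines.

Section flux.
Context {R : realType} {N : nat}.
Variable x0 : 'rV[R]_N.
Hypothesis g0 : 0 < gap x0.
Implicit Types (x : 'rV[R]_N) (i j : 'I_N) (a s : R).

Let q := cosh_dist x0.

Definition vol x := (2 / gap x) ^+ N.

Lemma sqrt_det_metric x : 0 < gap x -> Num.sqrt (\det (hyp_metric x)) = vol x.
Proof.
move=> g; rewrite /hyp_metric det_scalar -exprM mulnC exprM sqrtr_sqr ger0_norm//.
by rewrite exprn_ge0// divr_ge0// ltW.
Qed.

Lemma vol_gt0 x : 0 < gap x -> 0 < vol x.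
Proof. by move=> g; rewrite exprn_gt0// divr_gt0. Qed.

Lemma continuous_vol x : 0 < gap x -> {for x, continuous vol}.
Proof.
move=> g; apply: for_continuousX; apply: for_continuousM; first exact: for_continuous_cst.
by apply: for_continuousV; [exact: continuous_gap|rewrite gt_eqF].
Qed.

(** The i-th Euclidean component of the hyperbolic gradient of cosh r times the
    volume density, in a form without cancelling powers of gap x: the Euclidean
    divergence of this field is the density times the Laplacian of cosh r. *)
Definition flux i x := 2 ^+ N / gap x0 *
  (gap x * (x 0 i - x0 0 i) + sqn (x - x0) * x 0 i) / gap x ^+ N.

Definition dflux i x := 2 ^+ N / gap x0 *
  (gap x + sqn (x - x0) +
   2 * N%:R * x 0 i * (gap x * (x 0 i - x0 0 i) + sqn (x - x0) * x 0 i) / gap x)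
  / gap x ^+ N.

Lemma fluxE i x : 0 < gap x ->
  flux i x = vol x * (gap x / 2) ^+ 2 * grad_cosh x0 x 0 i.
Proof.
move=> g; rewrite /flux /vol !mxE expr_div_n.
have gN : gap x ^+ N != 0 by rewrite expf_neq0 ?gt_eqF.
by field; rewrite gN !gt_eqF.
Qed.

(** The Laplacian of cosh r is N cosh r. *)
Lemma sum_dflux x : 0 < gap x -> \sum_i dflux i x = vol x * (N%:R * q x).
Proof.
move=> g; rewrite /dflux -mulr_suml -mulr_sumr big_split/= sumr_const card_ord.
have -> : \sum_i 2 * N%:R * x 0 i *
       (gap x * (x 0 i - x0 0 i) + sqn (x - x0) * x 0 i) / gap x =
   2 * N%:R * (gap x * (sqn x - dotp x x0) + sqn (x - x0) * sqn x) / gap x.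
  rewrite -mulr_suml; congr (_ / _).
  rewrite /sqn /dotp -sumrB mulr_sumr mulr_sumr -big_split/= mulr_sumr.
  by apply: eq_bigr => i _; ring.
have D : sqn (x - x0) = sqn x + sqn x0 - 2 * dotp x x0.
  by rewrite !dotp_simp (dotpC x0 x); ring.
have -> : dotp x x0 = (2 - gap x - gap x0 - sqn (x - x0)) / 2.
  by rewrite D /gap; field.
have -> : sqn x = 1 - gap x by rewrite /gap; ring.
rewrite /vol /q /cosh_dist expr_div_n -[_ *+ N]mulr_natr.
have gN : gap x ^+ N != 0 by rewrite expf_neq0 ?gt_eqF.
by field; rewrite gN !gt_eqF.
Qed.

Lemma is_derive_flux i t a : 0 < gap (line t i a) ->
  is_derive a 1 (fun s => flux i (line t i s)) (dflux i (line t i a)).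
Proof.
set x := line t i a => g.
have cd := is_derive_line_coord t i a.
have dE (y : 'rV[R]_N) : dotp y (delta_mx 0 i) = y 0 i.
  rewrite /dotp (bigD1 i)//= mxE !eqxx mulr1 big1 ?addr0// => j ji.
  by rewrite mxE eqxx (negbTE ji) mulr0.
have h1 := is_derive_gap cd; rewrite dE -/x in h1.
have h2 : is_derive a 1 (fun s => sqn (line t i s - x0)) (2 * (x - x0) 0 i).
  rewrite -dE; apply: is_derive_sqn => j; have ? := cd j.
  have -> : (fun s => (line t i s - x0) 0 j) = (fun s => line t i s 0 j - x0 0 j).
    by apply/funext => s; rewrite !mxE.
  by apply: is_derive_eq; rewrite subr0.
have h3 := cd i; rewrite mxE !eqxx in h3.
have h4 : is_derive a 1 (fun s => gap (line t i s) ^+ N)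
    (N%:R * gap x ^+ N.-1 * - (2 * x 0 i)).
  have -> : (fun s => gap (line t i s) ^+ N) = (fun s => gap (line t i s)) ^+ N.
    by apply/funext => s; rewrite exprfctE.
  by apply: is_derive_eq; rewrite /GRing.scale /= -/x; ring.
have gn : gap (line t i a) ^+ N != 0 by rewrite expf_neq0// gt_eqF.
have h5 := @is_deriveV R (fun s => gap (line t i s) ^+ N) a _ 1 gn h4.
have -> : (fun s => flux i (line t i s)) = (fun s => (2 ^+ N / gap x0) *
   ((gap (line t i s) * (line t i s 0 i - x0 0 i) +
       sqn (line t i s - x0) * line t i s 0 i) *
     (gap (line t i s) ^+ N)^-1)).
  by apply/funext => s; rewrite /flux mulrA.
apply: is_derive_eq; rewrite /GRing.scale /= -/x /dflux -/x.
rewrite ![(x - x0) 0 i]mxE [(- x0) 0 i]mxE.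
have [N0|Nn] := eqVneq N 0%N.
  by exfalso; case: i {x g cd h1 h2 h3 h4 h5 gn dE} => m; rewrite N0.
have -> : gap x ^+ N = gap x * gap x ^+ N.-1 by rewrite -exprS prednK// lt0n.
rewrite -/x in gn; have gn' : gap x ^+ N.-1 != 0 by rewrite expf_neq0// gt_eqF.
by field; rewrite gn' !gt_eqF.
Qed.

Lemma continuous_flux i x : 0 < gap x -> {for x, continuous (flux i)}.
Proof.
move=> g; have cgap := @continuous_gap R N x; have ccoord := @for_continuous_coord R N x i.
have ccst := @for_continuous_cst R 'rV[R]_N x.
apply: for_continuousM.
  apply: for_continuousM => //; apply: for_continuousD; apply: for_continuousM => //.
    exact: for_continuousB.
  exact: continuous_sqnB.
by apply: for_continuousV; [exact: for_continuousX|rewrite expf_neq0// gt_eqF].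
Qed.

Lemma continuous_dflux i x : 0 < gap x -> {for x, continuous (dflux i)}.
Proof.
move=> g; have cgap := @continuous_gap R N x; have ccoord := @for_continuous_coord R N x i.
have ccst := @for_continuous_cst R 'rV[R]_N x; have csq := @continuous_sqnB R N x0 x.
apply: for_continuousM.
  apply: for_continuousM => //; apply: for_continuousD; first exact: for_continuousD.
  apply: for_continuousM; last by apply: for_continuousV => //; rewrite gt_eqF.
  apply: for_continuousM.
    by apply: for_continuousM => //; exact: ccst.
  by apply: for_continuousD; apply: for_continuousM => //; exact: for_continuousB.
by apply: for_continuousV; [exact: for_continuousX|rewrite expf_neq0// gt_eqF].
Qed.

End flux.

Section test_field.
Context {R : realType} {N : nat}.
Local Notation RR := (measurableTypeR R).
Implicit Types (x : 'rV[R]_N) (i j : 'I_N) (a s y : R) (t : N.-tuple RR).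

Section compact_support.
Variable K : set 'rV[R]_N.
Hypotheses (cK : compact K) (KU : forall x, K x -> 0 < gap x).

Lemma open_offK : open (~` K).
Proof. by apply: closed_openC; apply: compact_closed => //; exact: norm_hausdorff. Qed.

Lemma near_offK x : ~ K x -> \forall y \near x, ~ K y.
Proof. by move=> nKx; apply: open_nbhs_nbhs; split => //; exact: open_offK. Qed.

Lemma continuous_supp (f : 'rV[R]_N -> R) : (forall x, ~ K x -> f x = 0) ->
  (forall x, 0 < gap x -> {for x, continuous f}) -> continuous f.
Proof.
move=> f0 cf x; have [/KU gx|nKx] := pselect (K x); first exact: cf.
apply: (near_cst_continuous 0); near=> y; apply: f0.
by near: y; exact: near_offK.
Unshelve. all: by end_near. Qed.

Lemma bounded_supp (f : 'rV[R]_N -> R) : (forall x, ~ K x -> f x = 0) ->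
  continuous f -> exists M : R, forall x, `|f x| <= M.
Proof.
move=> f0 cf; have cfK : compact (f @` K).
  by apply: continuous_compact => //; exact: continuous_subspaceT.
have [M [_ /(_ (M + 1))]] := compact_bounded cfK.
rewrite ltrDl ltr01 => /(_ isT) MK; exists (Num.max (M + 1) 0) => x.
rewrite le_max; have [Kx|nKx] := pselect (K x).
  by apply/orP; left; apply: MK; exists x.
by rewrite f0// normr0 lexx orbT.
Qed.

Lemma supp_cube t : K (row_of_tuple t) -> cube t.
Proof.
move=> /KU; rewrite /gap subr_gt0 => h i; rewrite in_itv/= -ler_norml.
have : (tnth t i : R) ^+ 2 < 1.
  apply: le_lt_trans h; rewrite /sqn (bigD1 i)//= mxE lerDl.
  by apply: sumr_ge0 => j _; exact: sqr_ge0.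
by rewrite -[X in X < 1]real_normK ?num_real// => h1; have := normr_ge0 (tnth t i : R); nra.
Qed.

Lemma integrable_supp (f : 'rV[R]_N -> R) : (forall x, ~ K x -> f x = 0) ->
  continuous f ->
  (@lebesgue_tuple R N).-integrable setT (fun t => (f (row_of_tuple t))%:E).
Proof.
move=> f0 cf; have [M fM] := bounded_supp f0 cf.
apply: (@integrable_cube _ _ _ _ (@cube R N) (fun t => f (row_of_tuple t)) M).
- exact: measurable_cube.
- exact: cube_fin.
- exact: measurable_continuous_row.
- by move=> t; exact: fM.
- by move=> t nt; apply: f0 => /supp_cube.
Qed.

(** On each line parallel to the i-th axis, f is the derivative of a function
    that vanishes at both ends of [-2, 2]; the unit ball lies well inside. *)
Lemma integral_partial_eq0 i (F f : 'rV[R]_N -> R) :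
  (forall x, ~ K x -> F x = 0) -> (forall x, ~ K x -> f x = 0) -> continuous f ->
  (forall t a, is_derive a 1 (fun s => F (line t i s)) (f (line t i a))) ->
  (\int[@lebesgue_tuple R N]_t (f (row_of_tuple t))%:E = 0)%E.
Proof.
move=> F0 f0 cf Ff; have [M fM] := bounded_supp f0 cf.
apply: (@integral_lines_eq0 R N i (fun t => f (row_of_tuple t)) M) => //.
- exact: measurable_continuous_row.
- by move=> t nt; apply: f0 => /supp_cube.
move=> t; have off a : ~ (-2 < a < 2) -> ~ K (line t i a).
  move=> na /KU; rewrite /gap subr_gt0 => h; apply: na.
  have : a ^+ 2 < 1.
    apply: le_lt_trans h; rewrite /sqn (bigD1 i)//= lineE eqxx lerDl.
    by apply: sumr_ge0 => j _; exact: sqr_ge0.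
  by move=> h2; apply/andP; split; nra.
transitivity (\int[@lebesgue_measure R]_(a in `[(-2)%R, 2%R]) (f (line t i a))%:E)%E.
  rewrite [RHS]integral_mkcond; apply: eq_integral => a _.
  rewrite patchE; case: ifPn => //; rewrite notin_setE/= in_itv/= => h.
  rewrite -/(line t i a) f0//; apply: off => /andP[/ltW h1 /ltW h2].
  by apply: h; rewrite h1.
have lt22 : (-2 : R) < 2 by lra.
rewrite (@FTC_segment R (fun a => F (line t i a)) (fun a => f (line t i a)))//.
  rewrite !F0 ?subee//; apply: off => /andP[]; rewrite ?ltxx//.
move=> a _; apply: (@continuous_comp _ _ _ (line t i) f); last exact: cf.
exact: continuous_line.
Qed.

End compact_support.

Section with_u.
Variables (p : R) (x0 : 'rV[R]_N) (u : 'rV[R]_N -> R) (K : set 'rV[R]_N).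
Hypotheses (p2 : 2 <= p) (g0 : 0 < gap x0).
Hypotheses (cK : compact K) (KU : forall x, K x -> 0 < gap x).
Hypotheses (u0 : forall x, ~ K x -> u x = 0).
Hypotheses (uD : forall x, differentiable u x).
Hypotheses (uC : forall i, continuous ('D_(delta_mx 0 i) u)).

Let q := cosh_dist x0.
Let du x : 'rV[R]_N := \row_i 'D_(delta_mx 0 i) u x.

Lemma du_off x i : ~ K x -> 'D_(delta_mx 0 i) u x = 0.
Proof.
move=> nKx; rewrite (@near_eq_derive _ _ _ _ (cst 0)) ?derive_cst//.
by near=> y; apply: u0; near: y; exact: near_offK.
Unshelve. all: by end_near. Qed.

Lemma continuous_u : continuous u.
Proof. by move=> x; exact: differentiable_continuous. Qed.

Lemma powR_abs_off x : ~ K x -> `|u x| `^ p = 0.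
Proof. by move=> /u0 ->; rewrite normr0 powR0// gt_eqF//; have := p2; lra. Qed.

Lemma continuous_pow_abs_u : continuous (fun x => `|u x| `^ p).
Proof.
move=> x; apply: (@for_continuous_comp R _ x u _ (fun z => `|z| `^ p)).
  exact: continuous_u.
exact: is_derive1_continuous (is_derive_pow_abs _ p2).
Qed.

Variables (w dw : R -> R).
Hypotheses (wd : forall y, 1 <= y -> is_derive y 1 w (dw y)).
Hypotheses (cdw : forall y, 1 <= y -> {for y, continuous dw}).

(** The i-th component of |u|^p w(cosh r) grad (cosh r), with the volume
    density. *)
Definition test_field i x := `|u x| `^ p * (w (q x) * flux x0 i x).

Definition dtest_field i x :=
  dpow_abs p (u x) * 'D_(delta_mx 0 i) u x * (w (q x) * flux x0 i x) +
  `|u x| `^ p * (dw (q x) * grad_cosh x0 x 0 i * flux x0 i x + w (q x) * dflux x0 i x).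

Lemma dtest_field_off i x : ~ K x -> dtest_field i x = 0.
Proof.
by move=> nKx; rewrite /dtest_field du_off// powR_abs_off// mulr0 !mul0r addr0.
Qed.

Lemma continuous_comp_q (h : R -> R) x : 0 < gap x ->
  (forall y, 1 <= y -> {for y, continuous h}) -> {for x, continuous (fun z => h (q z))}.
Proof.
move=> g ch; apply: for_continuous_comp; first exact: continuous_cosh_dist.
by apply: ch; exact: cosh_dist_ge1.
Qed.

Lemma continuous_dtest_field i : continuous (dtest_field i).
Proof.
apply: (continuous_supp cK KU) => [x|x g]; first exact: dtest_field_off.
have cw : {for x, continuous (fun z => w (q z))}.
  by apply: continuous_comp_q => // y /wd; exact: is_derive1_continuous.
have cdwq : {for x, continuous (fun z => dw (q z))} by exact: continuous_comp_q.
have cfl : {for x, continuous (flux x0 i)} by exact: continuous_flux.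
apply: for_continuousD; apply: for_continuousM.
- apply: for_continuousM; last exact: uC.
  by apply: for_continuous_comp; [exact: continuous_u|exact: continuous_dpow_abs].
- exact: for_continuousM.
- exact: continuous_pow_abs_u.
- apply: for_continuousD.
    apply: for_continuousM => //; apply: for_continuousM => //.
    exact: continuous_grad_cosh.
  by apply: for_continuousM => //; exact: continuous_dflux.
Qed.

Lemma is_derive_test_field i t a :
  is_derive a 1 (fun s => test_field i (line t i s)) (dtest_field i (line t i a)).
Proof.
have [Kx|nKx] := pselect (K (line t i a)); last first.
  rewrite dtest_field_off//; apply: (@near_eq_is_derive _ _ _ (cst 0)).
  have : \forall s \near a, ~ K (line t i s).
    exact: (continuous_line (near_offK cK nKx)).
  by apply: filterS => s nK; rewrite /test_field powR_abs_off// mul0r.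
have g := KU Kx.
have cd := is_derive_line_coord t i a.
have dE (y : 'rV[R]_N) : dotp y (delta_mx 0 i) = y 0 i.
  rewrite /dotp (bigD1 i)//= mxE !eqxx mulr1 big1 ?addr0// => j ji.
  by rewrite mxE eqxx (negbTE ji) mulr0.
have hq := is_derive_cosh_dist cd g0 g; rewrite dE in hq.
have hu : is_derive a 1 (fun s => u (line t i s)) ('D_(delta_mx 0 i) u (line t i a)).
  by apply: is_derive_line; exact: diff_derivable.
have hp := @is_derive1_comp R (fun z => `|z| `^ p) (fun s => u (line t i s)) a _ _
  (is_derive_pow_abs _ p2) hu.
have q1 : 1 <= q (line t i a) by exact: cosh_dist_ge1.
have hw := @is_derive1_comp R w (fun s => q (line t i s)) a _ _ (wd q1) hq.
have hf := is_derive_flux g0 g.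
have h1 := is_deriveM hw hf; have h2 := is_deriveM hp h1.
move: h2; set d := (X in is_derive _ _ _ X).
have -> : d = dtest_field i (line t i a).
  by rewrite /d /dtest_field /GRing.scale /= mulrfctE /= -/q; ring.
exact.
Qed.

Lemma integral_dtest_field i :
  (\int[@lebesgue_tuple R N]_t (dtest_field i (row_of_tuple t))%:E = 0)%E.
Proof.
apply: (integral_partial_eq0 cK KU (i := i) (F := test_field i)).
- by move=> x nKx; rewrite /test_field powR_abs_off// mul0r.
- by move=> x; exact: dtest_field_off.
- exact: continuous_dtest_field.
- exact: is_derive_test_field.
Qed.

(** The two terms are |u|^(p-2) u <grad u, w grad cosh r> times p, and |u|^p
    times the hyperbolic divergence of the field w(cosh r) grad cosh r. *)
Lemma sum_dtest_field x : 0 < gap x ->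
  \sum_i dtest_field i x = vol x * (
    dpow_abs p (u x) * w (q x) * ((gap x / 2) ^+ 2 * dotp (du x) (grad_cosh x0 x)) +
    `|u x| `^ p * (dw (q x) * (q x ^+ 2 - 1) + N%:R * q x * w (q x))).
Proof.
move=> g; rewrite /dtest_field big_split/=.
have -> : \sum_i dpow_abs p (u x) * 'D_(delta_mx 0 i) u x * (w (q x) * flux x0 i x) =
    vol x * (dpow_abs p (u x) * w (q x) *
      ((gap x / 2) ^+ 2 * dotp (du x) (grad_cosh x0 x))).
  rewrite /dotp !mulr_sumr; apply: eq_bigr => i _.
  by rewrite fluxE// [du x 0 i]mxE; ring.
have -> : \sum_i `|u x| `^ p *
     (dw (q x) * grad_cosh x0 x 0 i * flux x0 i x + w (q x) * dflux x0 i x)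
   = `|u x| `^ p * (dw (q x) * (vol x * (gap x / 2) ^+ 2 * sqn (grad_cosh x0 x)) +
       w (q x) * (vol x * (N%:R * q x))).
  rewrite -mulr_sumr big_split/= -mulr_sumr sum_dflux//; congr (_ * (_ + _)).
  rewrite /sqn !mulr_sumr; apply: eq_bigr => i _.
  by rewrite fluxE//; ring.
rewrite sqn_grad_cosh// -/q; field; rewrite gt_eqF//.
Qed.

End with_u.
End test_field.

(** * The pointwise inequality *)

Section pointwise_inequality.
Context {R : realType}.
Implicit Types (p a y e : R).

Lemma young_powR p (x y : R) : 1 < p -> 0 <= x -> 0 <= y ->
  p * x * y `^ (p - 1) <= x `^ p + (p - 1) * y `^ p.
Proof.
move=> p1 x0 y0; have p0 : 0 < p by lra.
have q0 : 0 < p / (p - 1) by rewrite divr_gt0// subr_gt0.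
have pq : p^-1 + (p / (p - 1))^-1 = 1 by field; rewrite !gt_eqF// subr_gt0.
have := @conjugate_powR R x (y `^ (p - 1)) p (p / (p - 1)) x0 (powR_ge0 _ _) p0 q0 pq.
rewrite -powRrM (_ : (p - 1) * (p / (p - 1)) = p); last by field; rewrite gt_eqF// subr_gt0.
rewrite -(ler_pM2l p0).
have -> : p * (x `^ p / p + y `^ p / (p / (p - 1))) = x `^ p + (p - 1) * y `^ p.
  by field; rewrite !gt_eqF// subr_gt0.
by rewrite mulrA.
Qed.

Lemma norm_dpow_abs p (z : R) : 2 <= p -> `|dpow_abs p z| = p * `|z| `^ (p - 1).
Proof.
move=> p2; rewrite /dpow_abs 2!normrM (@ger0_norm _ p); last lra.
rewrite (ger0_norm (powR_ge0 _ _)) -mulrA; congr (_ * _).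
have [->|zn] := eqVneq z 0.
  by rewrite normr0 mulr0 powR0// gt_eqF//; lra.
rewrite -[X in _ * X]powRr1// -gt0_powRD ?normr_gt0//; congr (_ `^ _); ring.
Qed.

Lemma continuous_arcosh y : 1 < y -> {for y, continuous (@arcosh R)}.
Proof. by move=> /is_derive_arcosh; exact: is_derive1_continuous. Qed.

Lemma continuous_sinh : continuous (@sinh R).
Proof. by move=> y; exact: is_derive1_continuous (is_derive_sinh y). Qed.

Lemma continuous_dradial_field p a y : 2 <= p -> p - 1 <= a -> 1 < y ->
  {for y, continuous (dradial_field p a)}.
Proof.
move=> p2 ap y1; have r0 := arcosh_gt0 y1; have ca := continuous_arcosh y1.
have h0 : 0 < y ^+ 2 - 1 by nra.
have cid : {for y, continuous (fun z : R => z)} by exact: cvg_id.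
have ccst := @for_continuous_cst R R y.
have c2 : {for y, continuous (fun z : R => z ^+ 2 - 1)}.
  by apply: for_continuousB => //; exact: for_continuousX.
have cs : {for y, continuous (fun z => slope p a (arcosh z))}.
  apply: for_continuous_comp => //; exact: is_derive1_continuous (is_derive_slope _ _ r0).
have s0 := slope_gt0 p2 ap r0.
apply: for_continuousB.
  apply: for_continuousM; last by apply: for_continuousV => //; rewrite gt_eqF.
  apply: for_continuousM.
    by apply: for_continuousM => //; exact: continuous_powR_gt0.
  have csh : {for y, continuous (fun z => sinh (arcosh z))}.
    by apply: for_continuous_comp => //; exact: continuous_sinh.
  apply: for_continuousD; apply: for_continuousM => //; apply: for_continuousV.
  - exact: for_continuousX.
  - by rewrite expf_neq0// gt_eqF ?sinh_gt0.
  - exact: for_continuousX.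
  - by rewrite expf_neq0// gt_eqF.
apply: for_continuousM; last first.
  apply: for_continuousV; last by rewrite expf_neq0// gt_eqF ?sqrtr_gt0.
  apply: for_continuousX; apply: (@for_continuous_comp _ _ _ _ _ Num.sqrt) => //.
  exact: sqrt_continuous.
by apply: for_continuousM => //; exact: continuous_powR_gt0.
Qed.

Lemma continuous_cutoffM e (k : R -> R) y : 0 < e ->
  (forall z : R, 1 < z -> {for z, continuous k}) -> 1 <= y ->
  {for y, continuous (fun z => cutoff e z * k z)}.
Proof.
move=> e0 ck; rewrite le_eqVlt => /predU1P[<-|y1]; last first.
  apply: for_continuousM; last exact: ck.
  exact: is_derive1_continuous (is_derive_cutoff e y1).
apply: (near_cst_continuous 0); near=> z.
have z1 : z <= 1 + e by rewrite ltW//; near: z; apply: lt_nbhsl; lra.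
by rewrite cutoff_eq0 ?mul0r.
Unshelve. all: by end_near. Qed.

Section at_a_point.
Context {N : nat}.
Variables (p : R) (x0 : 'rV[R]_N) (u : 'rV[R]_N -> R).
Let a := (N%:R - 1) / p.
Hypotheses (p2 : 2 <= p) (pN : 1 + p * (p - 1) <= N%:R) (g0 : 0 < gap x0).

Lemma le_slope_coef : p - 1 <= a.
Proof.
rewrite /a ler_pdivlMr; last by have := p2; lra.
by rewrite lerBrDl mulrC.
Qed.

Lemma N_slope_coef : N%:R = 1 + p * a.
Proof. by rewrite /a; field; rewrite gt_eqF//; have := p2; lra. Qed.

Lemma riem_norm_grad (x : 'rV[R]_N) : 0 < gap x -> riem_norm x (riem_grad u x) =
  gap x / 2 * Num.sqrt (sqn (\row_i 'D_(delta_mx 0 i) u x)).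
Proof.
move=> g; rewrite riem_normE// /riem_grad /hyp_metric invmx_scalar mul_mx_scalar.
rewrite -/(sqn x) -/(gap x) sqnZ sqrtrM ?sqr_ge0// sqrtr_sqr ger0_norm; last first.
  by rewrite invr_ge0 sqr_ge0.
by field; rewrite gt_eqF.
Qed.

Definition cut_field e y := cutoff e y * radial_field p a y.
Definition dcut_field e y :=
  dcutoff e y * radial_field p a y + cutoff e y * dradial_field p a y.

(** Let h = slope^(p-1), and let X = cutoff h grad r be the field of cut_field.
    Young's inequality bounds |p |u|^(p-2) u <grad u, X>| by
    |grad u|^p + (p-1) cutoff |u|^p slope^p, using cutoff <= 1; the divergence
    of X is at least cutoff times that of h grad r, as the cutoff is
    nondecreasing; what remains is the Riccati expression of the slope. *)
Lemma hardy_pointwise e x : 0 < e -> 0 < gap x ->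
  (1 < cosh_dist x0 x -> p = 2 \/ a <= slope p a (arcosh (cosh_dist x0 x))) ->
  cutoff e (cosh_dist x0 x) *
    (`|u x| `^ p * hardy_weight p a (arcosh (cosh_dist x0 x))) * vol x
  <= riem_norm x (riem_grad u x) `^ p * vol x +
     \sum_i dtest_field p x0 u (cut_field e) (dcut_field e) i x.
Proof.
move=> e0 g H; rewrite sum_dtest_field//.
set q := cosh_dist x0 x in H *; set G := riem_norm _ _.
have v0 := vol_gt0 g.
have := cosh_dist_ge1 g0 g; rewrite -/q le_eqVlt => /predU1P[q1|q1].
  have c0 : cutoff e q = 0 by apply: cutoff_eq0; rewrite -q1; lra.
  have d0 : dcutoff e q = 0 by apply: dcutoff_eq0; rewrite -q1; lra.
  rewrite /cut_field /dcut_field c0 d0 !(mulr0, mul0r, addr0).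
  by rewrite mulr_ge0 ?powR_ge0// ltW.
have {}H := H q1; set r := arcosh q in H *; have r0 : 0 < r by exact: arcosh_gt0.
have ap := le_slope_coef.
have s0 := slope_gt0 p2 ap r0; set s := slope p a r in H s0 *.
set th := cutoff e q; have th0 : 0 <= th by exact: cutoff_ge0.
have th1 : th <= 1 by apply: cutoff_le1; rewrite ltW.
have h0 : 0 < q ^+ 2 - 1 by nra.
have sg0 : 0 < Num.sqrt (q ^+ 2 - 1) by rewrite sqrtr_gt0.
rewrite [leLHS]mulrC [X in _ <= X + _]mulrC -mulrDr ler_pM2l//.
set W := hardy_weight p a r.
have G0 : 0 <= G by exact: riem_norm_ge0.
have p1 : 1 < p by have := p2; lra.
have T1 : - (th * (G `^ p + (p - 1) * (`|u x| * s) `^ p)) <=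
    dpow_abs p (u x) * cut_field e q * ((gap x / 2) ^+ 2 *
      dotp (\row_i 'D_(delta_mx 0 i) u x) (grad_cosh x0 x)).
  set dt := dotp _ _.
  have hdt : `|(gap x / 2) ^+ 2 * dt| <= G * Num.sqrt (q ^+ 2 - 1).
    rewrite normrM ger0_norm ?sqr_ge0//.
    apply: (@le_trans _ _ ((gap x / 2) ^+ 2 *
        (Num.sqrt (sqn (\row_i 'D_(delta_mx 0 i) u x)) *
        (2 / gap x * Num.sqrt (q ^+ 2 - 1))))).
      rewrite ler_wpM2l ?sqr_ge0//; apply: le_trans (ler_dotp _ _) _.
      rewrite sqn_grad_cosh// -/q sqrtrM ?sqr_ge0// sqrtr_sqr ger0_norm//.
      by rewrite divr_ge0// ltW.
    rewrite /G riem_norm_grad//; set S := Num.sqrt (sqn _).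
    rewrite le_eqVlt; apply/orP; left; apply/eqP.
    by field; rewrite gt_eqF.
  rewrite lerNl; apply: le_trans (ler_norm _) _; rewrite normrN.
  rewrite 2!normrM norm_dpow_abs//.
  rewrite /cut_field -/th (@ger0_norm _ (th * _)); last first.
    by rewrite mulr_ge0// radial_field_ge0.
  apply: (@le_trans _ _ (p * `|u x| `^ (p - 1) * (th * radial_field p a q) *
      (G * Num.sqrt (q ^+ 2 - 1)))).
    apply: ler_wpM2l => //; apply: mulr_ge0.
      by apply: mulr_ge0; [lra|exact: powR_ge0].
    by apply: mulr_ge0 => //; exact: radial_field_ge0.
  have -> : p * `|u x| `^ (p - 1) * (th * radial_field p a q) *
      (G * Num.sqrt (q ^+ 2 - 1)) =
    th * (p * G * (`|u x| * s) `^ (p - 1)).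
    rewrite powRM// ?(ltW s0)// /radial_field -/r -/s; field.
    by rewrite gt_eqF.
  rewrite ler_wpM2l//; apply: young_powR => //.
  by rewrite mulr_ge0// ltW.
have T2 : th * (s `^ (p - 2) * ((p - 1) * dslope p a r + p * a * coth r * s)) <=
   dcut_field e q * (q ^+ 2 - 1) + N%:R * q * cut_field e q.
  rewrite -(radial_field_div p2 ap q1 N_slope_coef) /dcut_field /cut_field -/th.
  rewrite [leRHS](_ : _ = dcutoff e q * radial_field p a q * (q ^+ 2 - 1) +
    th * (dradial_field p a q * (q ^+ 2 - 1) + N%:R * q * radial_field p a q));
    last by ring.
  rewrite lerDr mulr_ge0// ?(ltW h0)// mulr_ge0 ?radial_field_ge0//.
  by rewrite dcutoff_ge0// ltW.
have T3 := hardy_weight_le p2 ap r0 H; rewrite -/s -/W in T3.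
have U0 : 0 <= `|u x| `^ p by exact: powR_ge0.
have T4 : `|u x| `^ p * (th * (s `^ (p - 2) *
     ((p - 1) * dslope p a r + p * a * coth r * s))) <=
   `|u x| `^ p * (dcut_field e q * (q ^+ 2 - 1) + N%:R * q * cut_field e q).
  by rewrite ler_wpM2l.
apply: le_trans (lerD (lexx _) (lerD T1 T4)).
have -> : (`|u x| * s) `^ p = `|u x| `^ p * (s `^ (p - 2) * s ^+ 2).
  rewrite powRM// ?(ltW s0)//; congr (_ * _).
  by rewrite -powR_mulrn ?(ltW s0)// -gt0_powRD// subrK.
have T5 : th * `|u x| `^ p * W <= th * `|u x| `^ p * (s `^ (p - 2) *
    ((p - 1) * dslope p a r + p * a * coth r * s - (p - 1) * s ^+ 2)).
  by rewrite ler_wpM2l// mulr_ge0.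
have T6 : th * G `^ p <= G `^ p by rewrite ler_piMl// powR_ge0.
move: T5 T6; set U := `|u x| `^ p; set S := s `^ (p - 2); set Gp := G `^ p.
set Q := (p - 1) * dslope p a r + p * a * coth r * s => T5 T6.
have -> : Gp + (- (th * (Gp + (p - 1) * (U * (S * s ^+ 2)))) + U * (th * (S * Q))) =
  (Gp - th * Gp) + th * U * (S * (Q - (p - 1) * s ^+ 2)) by ring.
by rewrite mulrA; move: T5 T6; lra.
Qed.

End at_a_point.
End pointwise_inequality.

(** * Integration of the pointwise inequality *)

Section integration.
Context {R : realType}.
Local Notation RR := (measurableTypeR R).

(** Monotonicity without measurability, for the integral of a nonnegative
    function is a supremum over the simple functions below it. It applies to
    weights in the geodesic distance, an infimum over curves. *)
Lemma ge0_le_integral_any d (T : measurableType d) (mu : {measure set T -> \bar R})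
    (f g : T -> \bar R) : (forall x, (0 <= f x)%E) -> (forall x, (f x <= g x)%E) ->
  (\int[mu]_x f x <= \int[mu]_x g x)%E.
Proof.
move=> f0 fg; rewrite !ge0_integralTE//; last by move=> x; exact: le_trans (f0 x) (fg x).
apply: le_ereal_sup => _ [h hf <-]; exists h => // x.
exact: le_trans (hf x) (fg x).
Qed.

Lemma riem_integral_supp N (B : set 'rV[R]_N) (f : 'rV[R]_N -> R) :
  (forall x, ~ B x -> f x = 0) ->
  riem_integral B f = (\int[@lebesgue_tuple R N]_t
    (f (row_of_tuple t) * Num.sqrt (\det (hyp_metric (row_of_tuple t))))%:E)%E.
Proof.
move=> f0; rewrite /riem_integral integral_mkcond; apply: eq_integral => t _.
rewrite patchE; case: ifPn => //; rewrite notin_setE/= => nB.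
by rewrite -/(row_of_tuple t) f0 ?mul0r.
Qed.

Lemma riem_norm_v0 N (x : 'rV[R]_N) : riem_norm x 0 = 0.
Proof. by rewrite /riem_norm !mul0mx mxE sqrtr0. Qed.

Lemma hyperplane_null n (a : RR) :
  @lebesgue_tuple R n.+1 [set t | tnth t ord0 = a] = 0%E.
Proof.
rewrite /= /pushforward.
have -> : (@cons_pair _ RR n) @^-1` [set t | tnth t ord0 = a] = [set a] `*` setT.
  by apply/seteqP; split => -[b t] /=; rewrite tnth0 => // -[].
rewrite (product_measure1E (@lebesgue_measure R) (@lebesgue_tuple R n)) //.
by rewrite [X in (X * _)%E]lebesgue_measure_set1 mul0e.
Qed.

Lemma eq_integral_off_point N (x0 : 'rV[R]_N) (f g : N.-tuple RR -> R) : (0 < N)%N ->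
  measurable_fun setT f -> measurable_fun setT g ->
  (forall t, row_of_tuple t <> x0 -> f t = g t) ->
  (\int[@lebesgue_tuple R N]_t (f t)%:E = \int[@lebesgue_tuple R N]_t (g t)%:E)%E.
Proof.
case: N x0 f g => [//|n] x0 f g _ mf mg fg; apply: ae_eq_integral => //.
- exact/measurable_EFinP.
- exact/measurable_EFinP.
exists [set t | tnth t ord0 = (x0 0 ord0 : RR)]; split.
- have -> : [set t : n.+1.-tuple RR | tnth t ord0 = (x0 0 ord0 : RR)] =
    setT `&` (fun t : n.+1.-tuple RR => tnth t ord0) @^-1` [set x0 0 ord0 : R].
    by rewrite setTI.
  by apply: measurable_tnth.
- exact: hyperplane_null.
move=> t /= /not_implyP[_ fgt]; apply: contrapT => tx; apply: fgt.
by congr EFin; apply: fg => tx0; apply: tx; rewrite -tx0 mxE.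
Qed.

Let eps n : R := n.+1%:R^-1.

Lemma cutoff_cvg (y : R) : 1 <= y ->
  cutoff (eps n) y @[n --> \oo] --> ((1 < y)%R%:R : R).
Proof.
rewrite le_eqVlt => /predU1P[<-|y1].
  rewrite ltxx; apply: cvg_near_cst; apply: nearW => n.
  by apply: cutoff_eq0; rewrite lerDl invr_ge0.
rewrite y1; have y10 : y - 1 != 0 by rewrite gt_eqF// subr_gt0.
have -> : (1%:R : R) = pos_part (y - 1 - 0) ^+ 2 * ((y - 1) ^+ 2)^-1.
  by rewrite subr0 pos_part_id ?divff ?expf_neq0// subr_ge0 ltW.
apply: cvgM; last exact: cvg_cst.
have ch : {for 0, continuous (fun e : R => pos_part (y - 1 - e) ^+ 2)}.
  apply: for_continuousX; apply: for_continuous_comp; last exact: continuous_pos_part.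
  by apply: for_continuousB; [exact: for_continuous_cst|exact: cvg_id].
exact: (cvg_comp _ _ (@cvg_harmonic R) ch).
Qed.

Section main.
Context {N : nat}.
Variables (p : R) (x0 : 'rV[R]_N) (u : 'rV[R]_N -> R) (K : set 'rV[R]_N).
Let a := (N%:R - 1) / p.
Let q := cosh_dist x0.
Hypotheses (p2 : 2 <= p) (pN : 1 + p * (p - 1) <= N%:R) (g0 : 0 < gap x0).
Hypotheses (cK : compact K) (KU : forall x, K x -> 0 < gap x).
Hypotheses (u0 : forall x, ~ K x -> u x = 0).
Hypotheses (uD : forall x, differentiable u x).
Hypotheses (uC : forall i, continuous ('D_(delta_mx 0 i) u)).
Hypothesis Kslope : forall x, K x -> 1 < q x -> p = 2 \/ a <= slope p a (arcosh (q x)).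

Implicit Types (k : R -> R) (y e : R) (x : 'rV[R]_N) (i : 'I_N).

Definition weighted (k : R -> R) (x : 'rV[R]_N) := `|u x| `^ p * k (q x) * vol x.

Local Notation lint f := (\int[@lebesgue_tuple R N]_t (f (row_of_tuple t))%:E)%E.
Local Notation off_pole k := (fun y : R => (1 < y)%R%:R * k y).
Local Notation off_pole_hw :=
  (fun y : R => (1 < y)%R%:R * hardy_weight p a (arcosh y)).
Local Notation cut_hw e :=
  (fun y : R => cutoff e y * hardy_weight p a (arcosh y)).

Lemma weighted_off k x : ~ K x -> weighted k x = 0.
Proof. by move=> nK; rewrite /weighted (powR_abs_off p2 u0) ?mul0r. Qed.

Lemma continuous_weighted k : (forall y, 1 <= y -> {for y, continuous k}) ->
  continuous (weighted k).
Proof.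
move=> ck; apply: (continuous_supp cK KU) => [x|x g]; first exact: weighted_off.
apply: for_continuousM; last exact: continuous_vol.
apply: for_continuousM; first exact: continuous_pow_abs_u.
exact: continuous_comp_q.
Qed.

Lemma weighted_ge0 k x : (forall y, 1 <= y -> 0 <= k y) -> 0 <= weighted k x.
Proof.
move=> k0; have [/KU g|nK] := pselect (K x); last by rewrite weighted_off.
rewrite /weighted !mulr_ge0 ?powR_ge0//; last by rewrite ltW ?vol_gt0.
by apply: k0; exact: cosh_dist_ge1.
Qed.

Lemma weighted_cvg k x :
  weighted (fun y => cutoff (eps n) y * k y) x @[n --> \oo] -->
  weighted (off_pole k) x.
Proof.
have [/KU g|nK] := pselect (K x); last first.
  rewrite weighted_off//; apply: cvg_near_cst; apply: nearW => n; exact: weighted_off.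
apply: cvgM; last exact: cvg_cst; apply: cvgM; first exact: cvg_cst.
apply: cvgM; last exact: cvg_cst.
by apply: cutoff_cvg; exact: cosh_dist_ge1.
Qed.

Lemma eps_gt0 n : 0 < eps n. Proof. by rewrite invr_gt0. Qed.

Lemma measurable_weighted k : (forall y : R, 1 < y -> {for y, continuous k}) ->
  measurable_fun setT (fun t : N.-tuple RR =>
    weighted (off_pole k) (row_of_tuple t)).
Proof.
move=> ck; apply: (measurable_fun_cvg (h := fun n t =>
  weighted (fun y => cutoff (eps n) y * k y) (row_of_tuple t))).
  move=> n; apply: measurable_continuous_row; apply: continuous_weighted => y.
  by apply: continuous_cutoffM => //; exact: eps_gt0.
by move=> t _; exact: weighted_cvg.
Qed.

Lemma grad_off x : ~ K x -> riem_grad u x = 0.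
Proof.
move=> nK; rewrite /riem_grad; have -> : \row_i 'D_(delta_mx 0 i) u x = 0.
  by apply/rowP => i; rewrite !mxE (du_off cK u0).
by rewrite mul0mx.
Qed.

Definition energy x := riem_norm x (riem_grad u x) `^ p * vol x.

Lemma energy_off x : ~ K x -> energy x = 0.
Proof.
move=> nK; rewrite /energy grad_off// riem_norm_v0 powR0 ?mul0r// gt_eqF//.
by have := p2; lra.
Qed.

Lemma continuous_energy : continuous energy.
Proof.
apply: (continuous_supp cK KU) => [x|x g]; first exact: energy_off.
pose du (z : 'rV[R]_N) : 'rV[R]_N := \row_i 'D_(delta_mx 0 i) u z.
(* |z|^p is continuous in z also at z = 0, where the gradient vanishes. *)
have H : {for x, continuous
    (fun z => `|gap z / 2 * Num.sqrt (sqn (du z))| `^ p * vol z)}.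
  apply: for_continuousM; last exact: continuous_vol.
  apply: (@for_continuous_comp R _ x _ _ (fun z => `|z| `^ p)); last first.
    exact: is_derive1_continuous (is_derive_pow_abs _ p2).
  apply: for_continuousM.
    by apply: for_continuousM; [exact: continuous_gap|exact: for_continuous_cst].
  apply: (@for_continuous_comp _ _ _ _ _ Num.sqrt); last exact: sqrt_continuous.
  apply: continuous_sum_ord => i; apply: for_continuousX.
  have -> : (fun z => du z 0 i) = 'D_(delta_mx 0 i) u.
    by apply/funext => z; rewrite mxE.
  exact: uC.
have E : \forall z \near x,
    `|gap z / 2 * Num.sqrt (sqn (du z))| `^ p * vol z = energy z.
  have : \forall z \near x, 0 < gap z.
    exact: (@continuous_gap R N x [set r | 0 < r] (lt_nbhsr g)).
  apply: filterS => z gz; rewrite /energy riem_norm_grad// ger0_norm//.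
  by rewrite mulr_ge0 ?sqrtr_ge0// divr_ge0// ltW.
rewrite /prop_for /continuous_at -(nbhs_singleton E).
by apply: cvg_trans H; exact: (near_eq_cvg E).
Qed.

Lemma hardy_weight_ge0 y : 1 <= y -> 0 <= hardy_weight p a (arcosh y).
Proof.
move=> y1; have ap := le_slope_coef p2 pN; rewrite -/a in ap.
have q0 : 0 <= p - 2 by have := p2; lra.
have pp0 : 0 <= p by lra.
have a0 : 0 <= a by lra.
have b0 : 0 <= (p - 1) / p by rewrite divr_ge0//; lra.
rewrite /hardy_weight !addr_ge0 ?powR_ge0//.
  rewrite divr_ge0 ?powR_ge0// mulr_ge0 ?powR_ge0// addr_ge0 ?sqr_ge0//.
  by apply: mulr_ge0 => //; exact: mulr_ge0.
rewrite divr_ge0 ?powR_ge0// mulr_ge0 ?powR_ge0//.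
by apply: mulr_ge0 => //; rewrite subr_ge0.
Qed.

Lemma continuous_pow_arcosh (h : R -> R) y : (forall r, 0 < r -> 0 < h r) ->
  continuous h -> 1 < y -> {for y, continuous (fun y => (h (arcosh y) `^ p)^-1)}.
Proof.
move=> h0 ch y1; have hy := h0 _ (arcosh_gt0 y1).
apply: for_continuousV; last by rewrite gt_eqF// powR_gt0.
apply: continuous_powR_gt0 => //; apply: for_continuous_comp; last exact: ch.
exact: continuous_arcosh.
Qed.

Let k1 (y : R) : R := 1.
Let kr (y : R) := (arcosh y `^ p)^-1.
Let ks (y : R) := (sinh (arcosh y) `^ p)^-1.
Let Lam := a `^ p.
Let c1 := ((p - 1) / p) `^ (p - 2) * (((p - 1) / p) ^+ 2 + (p - 2) * a * ((p - 1) / p)).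
Let c2 := a * (a - (p - 1)) * ((p - 1) / p) `^ (p - 2).

Lemma continuous_hardy_weight y : 1 < y ->
  {for y, continuous (fun y => hardy_weight p a (arcosh y))}.
Proof.
move=> y1; have cst c := @for_continuous_cst R R y c.
have h1 : {for y, continuous kr}.
  by apply: (continuous_pow_arcosh (h := id)) => // z; exact: cvg_id.
have h2 : {for y, continuous ks}.
  apply: continuous_pow_arcosh => //; [exact: sinh_gt0|exact: continuous_sinh].
by apply: for_continuousD; [apply: for_continuousD|]; rewrite //; exact: for_continuousM.
Qed.

(** The divergences dtest_field of the pointwise inequality integrate to 0. *)
Lemma hardy_cutoff e : 0 < e ->
  (lint (weighted (cut_hw e))
   <= lint energy)%E.
Proof.
move=> e0; have ap := le_slope_coef p2 pN; rewrite -/a in ap.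
pose F i x := dtest_field p x0 u (cut_field (N := N) p e) (dcut_field (N := N) p e) i x.
have wd y : 1 <= y -> is_derive y 1 (cut_field (N := N) p e) (dcut_field (N := N) p e y).
  by apply: is_derive_cutoffM => // z; exact: is_derive_radial_field.
have cdw y : 1 <= y -> {for y, continuous (dcut_field (N := N) p e)}.
  apply: continuous_dcutoffM => // z z1; first exact: is_derive_radial_field.
  exact: continuous_dradial_field.
have F0 i : (\int[@lebesgue_tuple R N]_t (F i (row_of_tuple t))%:E = 0)%E.
  exact: (integral_dtest_field p2 g0 cK KU u0 uD uC wd cdw).
have cF i : continuous (F i) by exact: (continuous_dtest_field p2 g0 cK KU u0 uD uC wd cdw).
have Foff i x : ~ K x -> F i x = 0 by exact: (dtest_field_off x0 p2 cK u0).
have iF i := integrable_supp cK KU (Foff i) (cF i).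
have iE := integrable_supp cK KU energy_off continuous_energy.
have cW : continuous (weighted (cut_hw e)).
  apply: continuous_weighted => y; apply: continuous_cutoffM => // z.
  exact: continuous_hardy_weight.
have iW := integrable_supp cK KU (@weighted_off _) cW.
have -> : (lint energy =
    \int[@lebesgue_tuple R N]_t ((energy (row_of_tuple t))%:E +
      \sum_(i < N) (F i (row_of_tuple t))%:E))%E.
  rewrite integralD; [|exact: measurableT|exact: iE|]; last first.
    by apply: (integrable_sum measurableT) => i _; exact: iF.
  have -> : (\int[@lebesgue_tuple R N]_t (\sum_(i < N) (F i (row_of_tuple t))%:E) = 0)%E.
    rewrite integral_sum; [|exact: measurableT|exact: iF].
    by rewrite big1.
  by rewrite adde0.
apply: le_integral => //.
  by apply: integrableD => //; apply: (integrable_sum measurableT) => i _; exact: iF.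
move=> t _; rewrite sumEFin -EFinD lee_fin; set x := row_of_tuple t.
have [Kx|nK] := pselect (K x); last first.
  by rewrite weighted_off// energy_off// big1 ?addr0// => i _; exact: Foff.
have := @hardy_pointwise R N p x0 u p2 pN g0 e x e0 (KU Kx) (Kslope Kx).
by rewrite /weighted /energy mulrCA !mulrA.
Qed.

(** Monotone convergence as the cutoff increases to the indicator of the
    complement of the pole. *)
Lemma hardy_limit :
  (lint (weighted off_pole_hw)
   <= lint energy)%E.
Proof.
pose g n (t : N.-tuple RR) := (weighted (cut_hw (eps n)) (row_of_tuple t))%:E.
have mg n : measurable_fun setT (g n).
  apply/measurable_EFinP; apply: measurable_continuous_row; apply: continuous_weighted => y.
  by apply: continuous_cutoffM; [exact: eps_gt0|exact: continuous_hardy_weight].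
have gge0 n t : setT t -> (0 <= g n t)%E.
  move=> _; rewrite lee_fin; apply: weighted_ge0 => y y1.
  by rewrite mulr_ge0 ?cutoff_ge0// hardy_weight_ge0.
have gnd t : setT t -> {homo g^~ t : n m / (n <= m)%N >-> (n <= m)%E}.
  move=> _ n m nm; rewrite lee_fin; set x := row_of_tuple t.
  have [/KU gx|nK] := pselect (K x); last by rewrite !weighted_off.
  rewrite /weighted ler_wpM2r//; first by rewrite ltW ?vol_gt0.
  rewrite ler_wpM2l ?powR_ge0// ler_wpM2r ?hardy_weight_ge0 ?cosh_dist_ge1//.
  apply: cutoff_nincr; first exact: ltW (eps_gt0 _).
  by rewrite lef_pV2 ?posrE// ler_nat ltnS.
have := @cvg_monotone_convergence _ _ _ (@lebesgue_tuple R N) _ measurableT _ mg gge0 gnd.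
have -> : (fun t => limn (g^~ t)) = (fun t =>
    (weighted off_pole_hw (row_of_tuple t))%:E).
  apply/funext => t; apply/cvg_lim => //.
  by apply: cvg_EFin; [exact: nearW|exact: weighted_cvg].
move=> H; apply: (cvge_le _ H); apply: nearW => n; apply: hardy_cutoff; exact: eps_gt0.
Qed.

Lemma Lam_ge0 : 0 <= Lam. Proof. exact: powR_ge0. Qed.

Lemma c1_ge0 : 0 <= c1.
Proof.
have ap := le_slope_coef p2 pN; rewrite -/a in ap; have ? := p2.
have b0 : 0 <= (p - 1) / p by apply: divr_ge0; lra.
have q0 : 0 <= p - 2 by lra.
have a0 : 0 <= a by lra.
apply: mulr_ge0; first exact: powR_ge0.
apply: addr_ge0; first exact: sqr_ge0.
by apply: mulr_ge0 => //; exact: mulr_ge0.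
Qed.

Lemma c2_ge0 : 0 <= c2.
Proof.
have ap := le_slope_coef p2 pN; rewrite -/a in ap; have ? := p2.
apply: mulr_ge0; last exact: powR_ge0.
by apply: mulr_ge0; lra.
Qed.

Lemma hardy_split :
  (lint (weighted off_pole_hw)
  = Lam%:E * lint (weighted (off_pole k1))
  + c1%:E * lint (weighted (off_pole kr))
  + c2%:E * lint (weighted (off_pole ks)))%E.
Proof.
have cst1 (y : R) : 1 < y -> {for y, continuous k1} by move=> _; exact: for_continuous_cst.
have cr (y : R) : 1 < y -> {for y, continuous kr}.
  by move=> y1; apply: (continuous_pow_arcosh (h := id)) => // z; exact: cvg_id.
have cs (y : R) : 1 < y -> {for y, continuous ks}.
  move=> y1; apply: continuous_pow_arcosh => //; first exact: sinh_gt0.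
  exact: continuous_sinh.
have ind0 (y : R) : 0 <= (1 < y)%R%:R :> R by [].
have P0 k t : (forall y, 0 <= k y) ->
    (0 <= (weighted (off_pole k) (row_of_tuple t))%:E)%E.
  by move=> k0; rewrite lee_fin; apply: weighted_ge0 => y _; rewrite mulr_ge0.
have k10 y : 0 <= k1 y by exact: ler01.
have kr0 y : 0 <= kr y by rewrite invr_ge0 powR_ge0.
have ks0 y : 0 <= ks y by rewrite invr_ge0 powR_ge0.
have mP k : (forall y : R, 1 < y -> {for y, continuous k}) -> measurable_fun setT
    (fun t : N.-tuple RR => (weighted (off_pole k) (row_of_tuple t))%:E).
  by move=> ck; apply/measurable_EFinP; exact: measurable_weighted.
have Z c k : 0 <= c -> (forall y : R, 1 < y -> {for y, continuous k}) ->
    (forall y, 0 <= k y) ->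
  (c%:E * lint (weighted (off_pole k)) =
   \int[@lebesgue_tuple R N]_t
     (c%:E * (weighted (off_pole k) (row_of_tuple t))%:E))%E.
  move=> c0 ck k0; rewrite ge0_integralZl_EFin;
    [by []|exact: measurableT| |exact: mP|exact: c0].
  by move=> t _; exact: P0.
rewrite (Z _ _ Lam_ge0 cst1 k10) (Z _ _ c1_ge0 cr kr0) (Z _ _ c2_ge0 cs ks0).
have Zm c k : (forall y : R, 1 < y -> {for y, continuous k}) -> measurable_fun setT
    (fun t : N.-tuple RR => (c%:E * (weighted (off_pole k) (row_of_tuple t))%:E)%E).
  by move=> ck; apply: measurable_funeM; exact: mP.
have Z0 c k t : 0 <= c -> (forall y, 0 <= k y) ->
  (0 <= c%:E * (weighted (off_pole k) (row_of_tuple t))%:E)%E.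
  by move=> c0 k0; rewrite mule_ge0 ?lee_fin// -lee_fin P0.
rewrite -ge0_integralD; last first.
- exact: Zm.
- by move=> t _; apply: Z0 => //; exact: c1_ge0.
- exact: Zm.
- by move=> t _; apply: Z0 => //; exact: Lam_ge0.
- exact: measurableT.
rewrite -ge0_integralD; last first.
- exact: Zm.
- by move=> t _; apply: Z0 => //; exact: c2_ge0.
- by apply: emeasurable_funD; exact: Zm.
- by move=> t _; apply: adde_ge0; apply: Z0 => //; [exact: Lam_ge0|exact: c1_ge0].
- exact: measurableT.
apply: eq_integral => t _; rewrite -!EFinM -!EFinD; congr EFin.
by rewrite /weighted /hardy_weight /k1 /kr /ks /c1 /c2 /Lam; ring.
Qed.

Let dens x := Num.sqrt (\det (hyp_metric x)).

(** A general r stands for the geodesic distance. At the pole, where r = 0, the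
    quotients by r^p and sinh^p r take the value 0, like the limits of the
    weights that are cut off. *)
Lemma hardy_integrated (r : 'rV[R]_N -> R) :
  (forall x, K x -> arcosh (q x) <= r x) -> (forall x, K x -> x = x0 -> r x = 0) ->
  (Lam%:E * \int[@lebesgue_tuple R N]_t
      (`|u (row_of_tuple t)| `^ p * dens (row_of_tuple t))%:E
  + (c1%:E * \int[@lebesgue_tuple R N]_t
      (`|u (row_of_tuple t)| `^ p / r (row_of_tuple t) `^ p * dens (row_of_tuple t))%:E
  + c2%:E * \int[@lebesgue_tuple R N]_t
      (`|u (row_of_tuple t)| `^ p / sinh (r (row_of_tuple t)) `^ p *
        dens (row_of_tuple t))%:E)
  <= \int[@lebesgue_tuple R N]_t
      (riem_norm (row_of_tuple t) (riem_grad u (row_of_tuple t)) `^ p *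
        dens (row_of_tuple t))%:E)%E
  /\ (\int[@lebesgue_tuple R N]_t
      (`|u (row_of_tuple t)| `^ p * dens (row_of_tuple t))%:E)%E \is a fin_num.
Proof.
move=> rq r0; have N0 : (0 < N)%N.
  by move: pN; case: (posnP N) => // ->; have := p2; nra.
have uE t : `|u (row_of_tuple t)| `^ p * dens (row_of_tuple t) =
    weighted k1 (row_of_tuple t).
  have [/KU g|nK] := pselect (K (row_of_tuple t)); last first.
    by rewrite weighted_off// (powR_abs_off p2 u0)// mul0r.
  by rewrite /dens sqrt_det_metric// /weighted /k1 mulr1.
have cw1 : continuous (weighted k1).
  by apply: continuous_weighted => y _; exact: for_continuous_cst.
have IuE : (\int[@lebesgue_tuple R N]_t
    (`|u (row_of_tuple t)| `^ p * dens (row_of_tuple t))%:E =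
  lint (weighted k1))%E.
  by apply: eq_integral => t _; rewrite uE.
have fin : (lint (weighted k1))%E \is a fin_num.
  apply: integrable_fin_num => //.
  exact: (integrable_supp cK KU (@weighted_off k1) cw1).
split; last by rewrite IuE.
have -> : (\int[@lebesgue_tuple R N]_t
      (riem_norm (row_of_tuple t) (riem_grad u (row_of_tuple t)) `^ p *
        dens (row_of_tuple t))%:E =
   lint energy)%E.
  apply: eq_integral => t _; congr EFin.
  have [/KU g|nK] := pselect (K (row_of_tuple t)).
    by rewrite /energy /dens sqrt_det_metric.
  rewrite energy_off// grad_off// riem_norm_v0 powR0 ?mul0r// gt_eqF//.
  by have := p2; lra.
apply: le_trans hardy_limit; rewrite hardy_split -addeA; apply: leeD.
  rewrite IuE le_eqVlt; apply/orP; left; apply/eqP; congr (_ * _)%E.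
  apply: (eq_integral_off_point (x0 := x0)) => //.
  - exact: measurable_continuous_row.
  - by apply: measurable_weighted => y _; exact: for_continuous_cst.
  - move=> t tx; have [/KU g|nK] := pselect (K (row_of_tuple t));
      last by rewrite !weighted_off.
    by rewrite /weighted cosh_dist_gt1 ?mul1r//; exact/eqP.
have cmp (h : R -> R) : (forall s, 0 < s -> 0 < h s) -> h 0 = 0 ->
    (forall s s', 0 < s -> s <= s' -> h s <= h s') ->
  (\int[@lebesgue_tuple R N]_t (`|u (row_of_tuple t)| `^ p /
      h (r (row_of_tuple t)) `^ p * dens (row_of_tuple t))%:E
   <= lint (weighted (fun y => (1 < y)%R%:R * (h (arcosh y) `^ p)^-1)))%E.
  move=> h0 h00 hm; apply: ge0_le_integral_any => t.
    by rewrite lee_fin mulr_ge0 ?sqrtr_ge0// divr_ge0 ?powR_ge0.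
  rewrite lee_fin; set x := row_of_tuple t.
  have [Kx|nK] := pselect (K x); last first.
    by rewrite weighted_off// (powR_abs_off p2 u0)// !mul0r.
  have g := KU Kx; rewrite /dens sqrt_det_metric// /weighted ler_wpM2r ?(ltW (vol_gt0 g))//.
  rewrite ler_wpM2l ?powR_ge0//.
  have p0 : p != 0 by rewrite gt_eqF//; have := p2; lra.
  have [xx0|/eqP xx0] := eqVneq x x0.
    by rewrite (r0 _ Kx xx0) h00 powR0// invr0 mulr_ge0// invr_ge0 powR_ge0.
  have q1 : 1 < q x by apply: cosh_dist_gt1 => //; exact/eqP.
  rewrite q1 mul1r; have ar := arcosh_gt0 q1; have rx := rq _ Kx.
  have har := h0 _ ar; have hle := hm _ _ ar rx.
  rewrite lef_pV2 ?posrE ?powR_gt0//; last exact: lt_le_trans hle.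
  apply: ge0_ler_powR => //; rewrite ?nnegrE; [have := p2; lra|exact: ltW|].
  exact: le_trans (ltW har) hle.
apply: leeD; apply: lee_wpmul2l.
- by rewrite lee_fin c1_ge0.
- exact: (cmp id).
- by rewrite lee_fin c2_ge0.
- apply: cmp; [exact: sinh_gt0|exact: sinh0|].
  move=> s s' s0 ss; rewrite /sinh ler_wpM2r// lerB// ler_expR; lra.
Qed.

End main.
End integration.

(** * The theorem *)

(** Here a = (N-1)/p is the limit of the slope at infinity. Multiplied by
    r (exp (2 r) - 1), the inequality becomes the one that characterizes
    r < r_p. *)
Lemma le_slope_lt_rp {R : realType} (p N r : R) : 1 < p ->
  1 + p * (p - 1) <= N -> 0 < r -> r < rp p N ->
  (N - 1) / p <= slope p ((N - 1) / p) r.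
Proof.
move=> p1 pN r0; rewrite lt_rp// => h.
have e1 : 0 < expR (2 * r) - 1 by rewrite subr_gt0 expR_gt1 mulr_gt0.
have N1 : 0 < N - 1 by nra.
rewrite -subr_ge0 /slope.
have -> : (N - 1) / p * coth r - (p - 1) / p / r - (N - 1) / p =
    (N - 1) / (p * r * (expR (2 * r) - 1)) *
    (2 * r - (p - 1) / (N - 1) * (expR (2 * r) - 1)).
  have -> : coth r = 1 + 2 / (expR (2 * r) - 1) by rewrite -coth_sub1//; ring.
  by field; rewrite (gt_eqF e1) (gt_eqF N1) (gt_eqF r0) gt_eqF//; lra.
by rewrite mulr_ge0 ?divr_ge0 ?mulr_ge0 ?subr_ge0// ltW//; lra.
Qed.

Lemma hardy_constant_r {R : realType} (p N : R) : 2 <= p ->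
  (p - 1) `^ (p - 1) * (N * (p - 2) + 1) / p `^ p =
  ((p - 1) / p) `^ (p - 2) *
  (((p - 1) / p) ^+ 2 + (p - 2) * ((N - 1) / p) * ((p - 1) / p)).
Proof.
move=> p2; have p0 : 0 < p by lra. have p10 : 0 < p - 1 by lra.
have -> : (p - 1) `^ (p - 1) = (p - 1) `^ (p - 2) * (p - 1).
  by rewrite -[X in _ * X]powRr1 ?ltW// -gt0_powRD//; congr (_ `^ _); ring.
have -> : p `^ p = p `^ (p - 2) * p ^+ 2.
  by rewrite -powR_mulrn ?ltW// -gt0_powRD// subrK.
by rewrite gt0_powR_div//; field; rewrite !gt_eqF ?powR_gt0.
Qed.

Lemma hardy_constant_sinh {R : realType} (p N : R) : 2 <= p ->
  (N - 1) * (N - 1 - p * (p - 1)) * (p - 1) `^ (p - 2) / p `^ p =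
  (N - 1) / p * ((N - 1) / p - (p - 1)) * ((p - 1) / p) `^ (p - 2).
Proof.
move=> p2; have p0 : 0 < p by lra. have p10 : 0 < p - 1 by lra.
have -> : p `^ p = p `^ (p - 2) * p ^+ 2.
  by rewrite -powR_mulrn ?ltW// -gt0_powRD// subrK.
by rewrite gt0_powR_div//; field; rewrite !gt_eqF ?powR_gt0.
Qed.

Theorem theorem7p2 (R : realType) :
  [/\ (* r_p(N) is well defined for p > 2 *)
      forall p N : R, 2 < p -> 1 + p * (p - 1) <= N ->
        exists! r : R, is_rp p N r,
      forall (p : R) (N : nat) (x0 : 'rV[R]_N) (u : 'rV[R]_N -> R),
        2 <= p -> 1 + p * (p - 1) <= N%:R -> hyp_space x0 ->
        let B := geodesic_ball x0 (rp_ext p N%:R) in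
        let r x := geodesic_dist x x0 in
        let Lambda := ((N%:R - 1) / p) `^ p in
        let c1 := (p - 1) `^ (p - 1) * (N%:R * (p - 2) + 1) / p `^ p in
        let c2 := (N%:R - 1) * (N%:R - 1 - p * (p - 1)) * (p - 1) `^ (p - 2)
                    / p `^ p in
        let I_grad := riem_integral B
                        (fun x => riem_norm x (riem_grad u x) `^ p) in
        let I_u := riem_integral B (fun x => `|u x| `^ p) in
        let I_r := riem_integral B (fun x => `|u x| `^ p / r x `^ p) in
        let I_sinh := riem_integral B
                        (fun x => `|u x| `^ p / sinh (r x) `^ p) in
        test_function B u ->
        (I_grad - Lambda%:E * I_u >= c1%:E * I_r + c2%:E * I_sinh)%E,
      forall p N M : R, 2 < p -> 1 + p * (p - 1) <= N -> N < M ->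
        rp p N < rp p M,
      forall p : R, 2 < p -> rp p N @[N --> +oo] --> +oo &
      forall N p q : R, 3 < N -> 2 < p -> p < q ->
        q <= (1 + Num.sqrt (4 * N - 3)) / 2 -> rp q N < rp p N].
Proof.
split; [exact: is_rp_uniq| |exact: rp_increasing|exact: rp_cvgy|exact: rp_decreasing].
move=> p N x0 u p2 pN /hyp_spaceE g0 B r Lambda c1 c2 I_grad I_u I_r I_sinh.
move=> [smu [K [cK KB u0]]].
have KU x : K x -> 0 < gap x by move=> /KB [/hyp_spaceE].
have uD x : differentiable u x by have [/(_ x)] := smu 1%N.
have uC i : continuous ('D_(delta_mx 0 i) u).
  by have [_ /(_ (delta_mx 0 i))] := smu 1%N.
have p1 : 1 < p by lra.
have rq x : K x -> arcosh (cosh_dist x0 x) <= r x.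
  by move=> /KU g; exact: arcosh_le_geodesic_dist.
have r0 x : K x -> x = x0 -> r x = 0 by move=> _ ->; exact: geodesic_dist_refl.
have Kslope x : K x -> 1 < cosh_dist x0 x ->
    p = 2 \/ (N%:R - 1) / p <= slope p ((N%:R - 1) / p) (arcosh (cosh_dist x0 x)).
  move=> Kx q1; have [_] := KB _ Kx; rewrite /rp_ext; case: eqP => [|_]; first by left.
  rewrite lte_fin => rlt; right; apply: le_slope_lt_rp => //; first exact: arcosh_gt0.
  exact: le_lt_trans (rq _ Kx) rlt.
have [H fin] := hardy_integrated p2 pN g0 cK KU u0 uD uC Kslope rq r0.
have up0 x : ~ K x -> `|u x| `^ p = 0 by exact: (powR_abs_off p2 u0).
have offB x : ~ B x -> ~ K x by apply: contra_not; exact: KB.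
have IuE : I_u = (\int[@lebesgue_tuple R N]_t (`|u (row_of_tuple t)| `^ p *
    Num.sqrt (\det (hyp_metric (row_of_tuple t))))%:E)%E.
  by apply: riem_integral_supp => x /offB; exact: up0.
rewrite -IuE in fin.
rewrite leeBrDr; last by rewrite fin_numM.
rewrite addeC IuE /c1 /c2 hardy_constant_r// hardy_constant_sinh//.
rewrite /I_r /I_sinh /I_grad !riem_integral_supp; first exact: H.
- move=> x /offB nK; rewrite (grad_off cK u0)// riem_norm_v0 powR0// gt_eqF//; lra.
- by move=> x /offB nK; rewrite up0// mul0r.
- by move=> x /offB nK; rewrite up0// mul0r.
Qed.
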